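(* Let $p\in(0,1)$ and let $X_n$ be the number of correct guesses under the optimal strategy in the complete feedback game after one asymmetric single-shelf shuffle of $n$ cards with parameter $p$. Then \[ \mathbb{P}\left(\frac{X_n-\mathbb{E}(X_n)}{\sqrt{\mathrm{Var}(X_n)}}\le x\right)=\Phi(x)+O_p\left(n^{-1/2}\right), \] where $\Phi(x)=\frac{1}{\sqrt{2\pi}}\int_{-\infty}^{x}e^{-t^2/2}\,dt$; that is, there is a constant $C_p>0$ depending only on $p$ such that for all sufficiently large $n$ and all $x\in\mathbb{R}$ the absolute difference between the left-hand probability and $\Phi(x)$ is at most $C_p n^{-1/2}$.
   Context: Asymmetric single-shelf shuffle with parameter $p\in(0,1)$: start with an ordered deck of $n$ cards labelled $1,\dots,n$ (card $1$ on top). Cards are drawn one at a time from the bottom of the deck (card $n$ first, card $1$ last) and placed in a pile; independently, each drawn card is placed at the top of the pile with probability $p$ and at the bottom with probability $1-p$. Equivalently, let $\varepsilon_1,\dots,\varepsilon_{n-1}$ be independent Bernoulli$(p)$ ($\varepsilon_j=1$ iff card $j$ is placed at the top); the shuffled deck read from the top consists of the cards $j\le n-1$ with $\varepsilon_j=1$ in increasing order, then card $n$, then the cards with $\varepsilon_j=0$ in decreasing order. Complete feedback game: the player guesses the cards of the shuffled deck sequentially from the top; after each guess the card is shown and removed. Let $\nu=1$ if $p\ge\frac12$ and $\nu=\lfloor \log p/\log(1-p)\rfloor+1$ if $0<p<\frac12$. Optimal strategy used: let $j$ be the label of the last card shown ($j=0$ before the first guess). As long as neither card $n$ nor card $n-1$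 has been shown: if $p\ge\frac12$, guess $j+1$; if $p<\frac12$, guess $n$ when $n-j\le\nu$ and guess $j+1$ when $n-j>\nu$. Once card $n$ or $n-1$ has been shown, guess the remaining cards in decreasing order. $X_n=X_n(p)$ denotes the number of correct guesses under this strategy. *)

(* Defs.v *)
From HB Require Import structures.
From mathcomp Require Import all_boot all_order all_algebra.
From mathcomp Require Import all_classical all_reals all_analysis.

Set Implicit Arguments.
Unset Strict Implicit.
Unset Printing Implicit Defensive.

Import Order.TTheory GRing.Theory Num.Theory.
Import numFieldNormedType.Exports.

Local Open Scope classical_set_scope.
Local Open Scope ring_scope.

(* Cards are the naturals 1, ..., n and a deck is listed from the top. The coin
   of card j is [c i] with i : 'I_n of value j - 1. Card n, drawn first onto an
   empty pile, has a coin too, but its value does not matter. *)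
Definition shelf_shuffle (n : nat) (c : 'I_n -> bool) : seq nat :=
  foldl (fun pile i => if c i then (i : nat).+1 :: pile
                       else rcons pile (i : nat).+1)
        [::] (rev (enum 'I_n)).

Definition nu (R : realType) (p : R) : int :=
  if 2^-1 <= p then 1 else Num.floor (ln p / ln (1 - p)) + 1.

(* [shown] lists the cards already shown, the oldest first. *)
Definition guess (R : realType) (p : R) (n : nat) (shown : seq nat) : nat :=
  let j := last 0%N shown in
  if (n \in shown) || (n.-1 \in shown)
  then (\max_(k <- iota 1 n | k \notin shown) k)%N
  else if 2^-1 <= p then j.+1
  else if n%:Z - j%:Z <= nu p then n else j.+1.

Definition correct_guesses (R : realType) (p : R) (n : nat) (deck : seq nat)
    : nat :=
  (\sum_(t < size deck) (guess p n (take t deck) == nth 0 deck t))%N.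

Definition mutually_independent d d' (T : measurableType d)
    (T' : measurableType d') (R : realType) (P : probability T R)
    (I : finType) (X : I -> {RV P >-> T'}) : Prop :=
  forall (J : {set I}) (A : I -> set T'), (forall i, measurable (A i)) ->
    P (\bigcap_(i in [set` J]) (X i @^-1` A i)) =
    (\prod_(i in J) P (X i @^-1` A i))%E.

Definition iid_bernoulli d (T : measurableType d) (R : realType)
    (P : probability T R) (p : R) (I : finType) (X : I -> {RV P >-> bool})
    : Prop :=
  mutually_independent X /\
  forall i (A : set bool), distribution P (X i) A = bernoulli_prob p A.

Definition num_correct d (T : measurableType d) (R : realType)
    (P : probability T R) (p : R) (n : nat) (eps : 'I_n -> {RV P >-> bool})
    (w : T) : R :=
  (correct_guesses p n (shelf_shuffle (fun i => eps i w)))%:R.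

Definition Phi (R : realType) (x : R) : R :=
  (Num.sqrt (2 * pi))^-1 *
  \int[lebesgue_measure]_(t in `]-oo, x]) expR (- t ^+ 2 / 2).

(* Main.v *)
Require Import Defs.
From HB Require Import structures.
From mathcomp Require Import all_boot all_order all_algebra.
From mathcomp Require Import all_classical all_reals all_analysis.
From mathcomp Require Import ring lra zify.

Set Implicit Arguments.
Unset Strict Implicit.
Unset Printing Implicit Defensive.

Import Order.TTheory GRing.Theory Num.Theory.
Import numFieldNormedType.Exports.

Local Open Scope classical_set_scope.
Local Open Scope ring_scope.

(** The proof reduces the game to counting the descents of the coin sequence,
    that is, the places where a card put on top is followed by a card put at the
    bottom, and then proves a Berry-Esseen bound for that count.

    The game. After card [n] or [n - 1] is shown, every guess is correct. Before
    that, the cards shown are the labels of the heads in increasing order, and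
    guessing the successor of the last label fails when a run of heads starts,
    except at card [1]. Runs and descents alternate, and replacing the guess by
    [n] near the end affects a bounded number of guesses. Hence the number of
    correct guesses is [n - descents] up to a bounded error
    ([correct_guesses_descents]).

    The law of the descents. Conditioning on the first coin gives a two-term
    recursion for the generating function of the number of descents in [n]
    tosses: it is [U_n (p (1 - p) (1 - X))], where
    [U_(n+2) = U_(n+1) - X U_n] and [U_0 = U_1 = 1]. Up to normalisation [U_n] is
    a Chebyshev polynomial, so it factors as the product of the
    [1 - 4 cos(k pi / (n + 1))^2 X]. Since [4 p (1 - p) <= 1], each factor
    becomes [1 - r + r X] with [r] in [[0, 1]]: the number of descents has the
    law of a sum of independent Bernoulli variables ([descents_law]). Comparing
    the coefficients of [X] and [X^2] shows that its variance is at least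
    [p (1 - p) n / 4] ([pbvar_descent_params]).

    Normal approximation. For a sum [S] of independent Bernoulli variables
    [B_i] of parameter [r_i], with mean [mu] and standard deviation [s], one has
    the Stein identity
    [E (S - mu) f(S) = sum_i r_i (1 - r_i) E (f(S - B_i + 1) - f(S - B_i))].
    Applied to a bounded step function it shows that, averaged over [i], the
    variables [S - B_i] put mass at most [1 / (2 s)] on each integer. Applied to
    the solution of Stein's equation for the normal law, sampled at the points
    [(k - mu) / s], it yields the Kolmogorov bound: the second difference of
    that function is of order [s^-3], except for a term of order [s^-2] at the
    jump, and the concentration estimate supplies the missing factor [1 / s]
    ([pb_kolmogorov]).

    Conclusion. A statistic within a constant of [n - descents] has a mean
    within a constant of [n - mu] and a standard deviation within a constant of
    [s], so its normalised distribution function is that of the descents up to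
    a shift and a dilation, each of which moves [Phi] by [O(1 / s)]
    ([descents_transfer]). *)

(** * Sums of independent Bernoulli variables *)

Definition fdiff (R : zmodType) (f : nat -> R) (k : nat) : R := f k.+1 - f k.

(** The expectation of [f S], where [S] is a sum of independent Bernoulli
    variables of parameters [rs]. The recursion conditions on the first of
    them, so that most facts follow by induction on [rs]. *)
Fixpoint pbexp (R : pzRingType) (rs : seq R) (f : nat -> R) : R :=
  if rs is r :: rs' then
    (1 - r) * pbexp rs' f + r * pbexp rs' (fun k => f k.+1)
  else f 0%N.

(** This is [sum_i r_i (1 - r_i) E f(S - B_i)], where [B_i] is the [i]-th
    Bernoulli variable: the weighted sum that appears in the Stein
    identity [pbexp_stein]. *)
Fixpoint pbstein (R : pzRingType) (rs : seq R) (f : nat -> R) : R :=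
  if rs is r :: rs' then
    r * (1 - r) * pbexp rs' f
    + ((1 - r) * pbstein rs' f + r * pbstein rs' (fun k => f k.+1))
  else 0.

Definition pbmean (R : pzRingType) (rs : seq R) : R := \sum_(r <- rs) r.
Definition pbvar (R : pzRingType) (rs : seq R) : R :=
  \sum_(r <- rs) r * (1 - r).

Definition in01 (R : numDomainType) : {pred R} := fun r => 0 <= r <= 1.

Lemma eq_pbexp (A : pzRingType) (rs : seq A) f g :
  f =1 g -> pbexp rs f = pbexp rs g.
Proof.
elim: rs f g => [|r rs IH] f g fg /=; first exact: fg.
by congr (_ * _ + _ * _); apply: IH => k; rewrite ?fg.
Qed.

Lemma pbexpZ (A : comPzRingType) (rs : seq A) a f :
  pbexp rs (fun k => a * f k) = a * pbexp rs f.
Proof.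
elim: rs f => [|r rs IH] f //=.
by rewrite (IH f) (IH (fun k => f k.+1)) mulrDr !(mulrCA a).
Qed.

Section PB.
Variable R : realFieldType.
Implicit Types (rs : seq R) (f g : nat -> R).

Lemma eq_pbstein rs f g : f =1 g -> pbstein rs f = pbstein rs g.
Proof.
elim: rs f g => [|r rs IH] f g fg //=.
congr (_ * _ + (_ * _ + _ * _)); [exact: eq_pbexp|exact: IH|].
by apply: IH => k; rewrite fg.
Qed.

Lemma pbexpD rs f g : pbexp rs (fun k => f k + g k) = pbexp rs f + pbexp rs g.
Proof.
elim: rs f g => [|r rs IH] f g //=.
by rewrite (IH f g) (IH (fun k => f k.+1) (fun k => g k.+1)); ring.
Qed.

Lemma pbexp_cst rs a : pbexp rs (fun=> a) = a.
Proof. by elim: rs => [|r rs IH] //=; rewrite IH; ring. Qed.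

Lemma pbexpB rs f g : pbexp rs (fun k => f k - g k) = pbexp rs f - pbexp rs g.
Proof.
rewrite -mulN1r -pbexpZ -pbexpD; apply: eq_pbexp => k.
by rewrite mulN1r.
Qed.

Lemma pbsteinD rs f g :
  pbstein rs (fun k => f k + g k) = pbstein rs f + pbstein rs g.
Proof.
elim: rs f g => [|r rs IH] f g /=; first by rewrite addr0.
by rewrite pbexpD (IH f g) (IH (fun k => f k.+1) (fun k => g k.+1)); ring.
Qed.

Lemma pbsteinZ rs a f : pbstein rs (fun k => a * f k) = a * pbstein rs f.
Proof.
elim: rs f => [|r rs IH] f /=; first by rewrite mulr0.
by rewrite pbexpZ (IH f) (IH (fun k => f k.+1)); ring.
Qed.

Lemma pbstein_cst rs a : pbstein rs (fun=> a) = a * pbvar rs.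
Proof.
rewrite /pbvar; elim: rs => [|r rs IH] /=; first by rewrite big_nil mulr0.
by rewrite big_cons IH pbexp_cst; ring.
Qed.

Section Positive.
Variable rs : seq R.
Hypothesis rs01 : all (@in01 R) rs.

Lemma ge0_pbexp f : (forall k, 0 <= f k) -> 0 <= pbexp rs f.
Proof.
elim: rs rs01 f => [|r rs' IH] //= /andP[/andP[r0 r1] h] f f0.
by rewrite addr_ge0 // mulr_ge0 ?subr_ge0 ?IH.
Qed.

Lemma ge0_pbstein f : (forall k, 0 <= f k) -> 0 <= pbstein rs f.
Proof.
elim: rs rs01 f => [|r rs' IH] //= /andP[/andP[r0 r1] h] f f0.
have B0 : 0 <= pbexp rs' f.
  elim: rs' h f f0 {IH} => [|s ss IH] //= /andP[/andP[s0 s1] h] f f0.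
  by rewrite addr_ge0 // mulr_ge0 ?subr_ge0 ?IH.
by rewrite addr_ge0 ?addr_ge0 // !mulr_ge0 ?subr_ge0 ?IH.
Qed.

Lemma le_pbexp f g : (forall k, f k <= g k) -> pbexp rs f <= pbexp rs g.
Proof.
by move=> fg; rewrite -subr_ge0 -pbexpB ge0_pbexp // => k; rewrite subr_ge0.
Qed.

Lemma le_pbstein f g : (forall k, f k <= g k) -> pbstein rs f <= pbstein rs g.
Proof.
move=> fg; rewrite -subr_ge0 -mulN1r -pbsteinZ -pbsteinD ge0_pbstein // => k.
by rewrite mulN1r subr_ge0.
Qed.

Lemma pbvar_ge0 : 0 <= pbvar rs.
Proof.
by rewrite -[pbvar rs]mul1r -pbstein_cst ge0_pbstein.
Qed.

Lemma ler_norm_pbexp f : `|pbexp rs f| <= pbexp rs (fun k => `|f k|).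
Proof.
rewrite ler_norml -mulN1r -pbexpZ; apply/andP; split; apply: le_pbexp => k.
  by rewrite mulN1r lerNl -normrN ler_norm.
exact: ler_norm.
Qed.

End Positive.

(** Stein identity. For a single Bernoulli variable [B] of parameter [r],
    [E (B - r) f(B) = r (1 - r) (f 1 - f 0)]; a sum of independent variables is
    handled one summand at a time, the others being frozen. *)
Lemma pbexp_stein rs f :
  pbexp rs (fun k => (k%:R - pbmean rs) * f k) = pbstein rs (fdiff f).
Proof.
elim: rs f => [|r rs IH] f /=; first by rewrite /pbmean big_nil subrr mul0r.
rewrite -(IH f) -(IH (fun k => f k.+1)) /pbmean big_cons -/(pbmean rs).
set m := pbmean rs; rewrite /fdiff pbexpB.
rewrite (@eq_pbexp _ _ _ (fun k => (k%:R - m) * f k + (- r) * f k)); last first.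
  by move=> k; ring.
rewrite (@eq_pbexp _ _ (fun k => (k.+1%:R - (r + m)) * f k.+1)
   (fun k => (k%:R - m) * f k.+1 + (1 - r) * f k.+1)); last first.
  by move=> k; rewrite -natr1; ring.
by rewrite !pbexpD !pbexpZ; ring.
Qed.

(** Removing one summand moves [S] by at most one, so [pbstein] is close to
    [pbvar] times the expectation. *)
Lemma pbstein_pbexp rs f : all (@in01 R) rs ->
  `|pbstein rs f - pbvar rs * pbexp rs f| <= pbstein rs (fun k => `|fdiff f k|).
Proof.
rewrite /pbvar.
elim: rs f => [|r rs IH] f /=; first by rewrite big_nil mul0r subr0 normr0.
case/andP=> /andP[r0 r1] h; rewrite big_cons.
set V := \sum_(_ <- rs) _.
set g := fun k => f k.+1.
have IH1 := IH f h; have IH2 := IH g h.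
have E : r * (1 - r) * pbexp rs f + ((1 - r) * pbstein rs f + r * pbstein rs g) -
   (r * (1 - r) + V) * ((1 - r) * pbexp rs f + r * pbexp rs g) =
   - (r * (1 - r) * r * pbexp rs (fdiff f)) +
   ((1 - r) * (pbstein rs f - V * pbexp rs f) +
     r * (pbstein rs g - V * pbexp rs g)).
  by rewrite pbexpB; ring.
rewrite E; apply: (le_trans (ler_normD _ _)); apply: lerD; last first.
  apply: (le_trans (ler_normD _ _)); rewrite !normrM.
  by rewrite (ger0_norm r0) (@ger0_norm _ (1 - r)) ?subr_ge0 // lerD //
             ler_wpM2l // ?subr_ge0.
rewrite normrN !normrM (ger0_norm r0) (@ger0_norm _ (1 - r)) ?subr_ge0 //.
have n0 : 0 <= r * (1 - r) by rewrite mulr_ge0 // subr_ge0.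
rewrite -mulrA ler_wpM2l //.
apply: (@le_trans _ _ `|pbexp rs (fdiff f)|); last exact: ler_norm_pbexp.
by rewrite -[leRHS]mul1r ler_wpM2r.
Qed.

Lemma pbexp_variance rs :
  pbexp rs (fun k => (k%:R - pbmean rs) ^+ 2) = pbvar rs.
Proof.
rewrite (@eq_pbexp _ _ _ (fun k => (k%:R - pbmean rs) * (k%:R - pbmean rs))).
  rewrite (pbexp_stein rs (fun k => k%:R - pbmean rs)).
  rewrite (@eq_pbstein _ _ (fun=> 1)) ?pbstein_cst ?mul1r //.
  by move=> k; rewrite /fdiff -natr1; ring.
by move=> k; rewrite expr2.
Qed.

(** Cauchy-Schwarz, in the form [2 |x| <= x ^ 2 / s + s]. *)
Lemma pbexp_abs_dev rs (s : R) : all (@in01 R) rs ->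
  0 < s -> s ^+ 2 = pbvar rs ->
  pbexp rs (fun k => `|k%:R - pbmean rs|) <= s.
Proof.
move=> h s0 sV.
have : pbexp rs (fun k => `|k%:R - pbmean rs|) <=
  pbexp rs (fun k => (2 * s)^-1 * (k%:R - pbmean rs) ^+ 2 + s / 2).
  apply: le_pbexp => // k; set x := _ - _.
  rewrite -[x ^+ 2]real_normK ?num_real //; set y := `|x|.
  have -> : (2 * s)^-1 * y ^+ 2 + s / 2 = y + (y - s) ^+ 2 / (2 * s).
    by field; rewrite gt_eqF.
  by rewrite lerDl divr_ge0 ?sqr_ge0 // mulr_ge0 // ltW.
rewrite pbexpD (pbexpZ _ (2 * s)^-1 (fun k => (k%:R - pbmean rs) ^+ 2)).
rewrite pbexp_variance pbexp_cst -sV => /le_trans; apply.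
by rewrite le_eqVlt; apply/orP; left; apply/eqP; field; rewrite gt_eqF.
Qed.

(** The indicator that the step from [k] to [k + 1] crosses [a]: the difference
    of the indicator of [a < k]. *)
Definition jump (a : R) (k : nat) : R := (k%:R <= a < k.+1%:R)%R%:R.

Lemma jump_ge0 a k : 0 <= jump a k. Proof. exact: ler0n. Qed.

(** Concentration: the Stein identity for [1(k > a) - 1/2], a bounded function
    whose difference is [jump a]. *)
Lemma pbstein_jump rs (s a : R) : all (@in01 R) rs ->
  0 < s -> s ^+ 2 = pbvar rs -> pbstein rs (jump a) <= s / 2.
Proof.
move=> h s0 sV.
rewrite (@eq_pbstein _ _ (fdiff (fun k => (a < k%:R)%R%:R - 2^-1))); last first.
  move=> k; rewrite /jump /fdiff opprB addrA subrK.
  rewrite leNgt; case: (ltP a k%:R) => /= [ak|ka].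
    by rewrite (lt_trans ak) ?ltr_nat // subrr.
  by rewrite subr0.
rewrite -pbexp_stein; apply: (@le_trans _ _ (pbexp rs (fun k =>
   2^-1 * `|k%:R - pbmean rs|))).
  apply: le_pbexp => // k; apply: (le_trans (ler_norm _)).
  rewrite normrM mulrC ler_wpM2r //.
  by case: (_ < _) => /=; rewrite ler_norml; apply/andP; split; lra.
by rewrite pbexpZ mulrC ler_wpM2r ?invr_ge0 // pbexp_abs_dev.
Qed.

End PB.

(** * The normal distribution function *)

Section Gaussian.
Variable R : realType.
Implicit Types x y : R.

Lemma sqrt2pi_gt0 : 0 < Num.sqrt (2 * pi) :> R.
Proof. by rewrite sqrtr_gt0 mulr_gt0 // pi_gt0. Qed.

Definition phi x : R := (Num.sqrt (2 * pi))^-1 * expR (- x ^+ 2 / 2).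

Lemma phi_gt0 x : 0 < phi x.
Proof. by rewrite mulr_gt0 ?invr_gt0 ?sqrt2pi_gt0 // expR_gt0. Qed.

Lemma normal_pdf01 : normal_pdf 0 1 = phi.
Proof.
apply/funext => x; rewrite normal_pdfE ?oner_neq0 //.
rewrite /normal_peak /normal_fun subr0 expr1n mul1r mulr2n.
by rewrite /phi mulr_natl mulr2n.
Qed.

Lemma integrable_phi (A : set R) : measurable A ->
  (lebesgue_measure : measure (measurableTypeR R) R).-integrable A (EFin \o phi).
Proof.
move=> mA; apply: (@integrableS _ _ _ _ setT) => //.
by have := integrable_normal_pdf (0 : R) 1; rewrite normal_pdf01.
Qed.

Lemma Phi_phi x : Phi x = \int[lebesgue_measure]_(t in `]-oo, x]) phi t.
Proof.
rewrite RintegralZl //.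
have E : EFin \o (fun t : R => expR (- t ^+ 2 / 2)) =
  (fun t => ((Num.sqrt (2 * pi))%:E * (EFin \o phi) t)%E).
  apply/funext => t /=; rewrite -EFinM /phi mulrA divff ?mul1r //.
  by rewrite gt_eqF ?sqrt2pi_gt0.
by rewrite E; apply: integrableZl => //; exact: integrable_phi.
Qed.

Lemma Phi_normal x : Phi x = fine (normal_prob 0 1 `]-oo, x]).
Proof. by rewrite Phi_phi /normal_prob normal_pdf01. Qed.

Lemma Phi_ge0 x : 0 <= Phi x.
Proof. by rewrite Phi_normal fine_ge0. Qed.

Lemma Phi_le1 x : Phi x <= 1.
Proof.
rewrite Phi_normal -[1]/(fine 1%E) fine_le ?fin_num_measure //.
exact: probability_le1.
Qed.

(* The identity, as a random variable under the normal law, has distribution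
   function [Phi]; the limits of [Phi] are then those of a distribution
   function. *)
Let idR : measurableTypeR R -> R := idfun.

#[local] HB.instance Definition _ :=
  @isMeasurableFun.Build _ _ _ _ idR (@measurable_id _ _ setT).

Let P : probability _ R := normal_prob (0 : R) 1.
Let X : {RV P >-> R} := idR.

Let fine_cdf : fine \o cdf X = @Phi R.
Proof. by apply: funext => r; rewrite Phi_normal. Qed.

Lemma cvg_Phi_ninfty : Phi x @[x --> -oo] --> (0 : R).
Proof. by have /fine_cvg := cvg_cdfNy0 X; rewrite fine_cdf. Qed.

Lemma cvg_Phi_pinfty : Phi x @[x --> +oo] --> (1 : R).
Proof. by have /fine_cvg := cvg_cdfy1 X; rewrite fine_cdf. Qed.

Lemma continuous_phi : continuous phi.
Proof.
by rewrite -normal_pdf01; apply: continuous_normal_pdf; rewrite oner_neq0.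
Qed.

Lemma is_derive_Phi x : is_derive x 1 (@Phi R) (phi x).
Proof.
have xx : x < x + 1 by rewrite ltrDl.
have := continuous_FTC1 xx (integrable_phi (measurable_itv `]-oo, x + 1])).
move=> /(_ _ (@continuous_phi x))[|d e]; first exact: ltNyr.
have E : @Phi R = fun x => \int[lebesgue_measure]_(t in `]-oo, x]) phi t.
  by apply: funext => y; rewrite Phi_phi.
by rewrite derive1E -E in e d *.
Qed.

End Gaussian.

Section Mills.
Variable R : realType.
Implicit Types x y : R.

Lemma is_derive_half_sqr x : is_derive x 1 (fun y : R => y ^+ 2 / 2) x.
Proof.
have H := is_deriveZ (2^-1 : R) (is_deriveX 2 (is_derive_id x (1 : R))).
rewrite (_ : (fun y : R => y ^+ 2 / 2) = 2^-1 \*: (id ^+ 2)).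
  apply: (is_derive_eq H); rewrite /GRing.scale /=; by field.
by apply: funext => y; rewrite /= mulrC.
Qed.

Lemma is_derive_phi x : is_derive x 1 (@phi R) (- (x * phi x)).
Proof.
have H := is_deriveZ ((Num.sqrt (2 * pi))^-1 : R)
   (is_derive1_comp (is_derive_expR _) (is_deriveN (is_derive_half_sqr x))).
have E : @phi R = (Num.sqrt (2 * pi))^-1 \*: (expR \o - (fun y => y ^+ 2 / 2)).
  by apply/funext => y; rewrite /phi mulNr.
rewrite [X in is_derive _ _ X _]E; apply: (is_derive_eq H).
by rewrite -[expR _]/(expR (- (x ^+ 2 / 2))) /GRing.scale /= /phi mulNr; ring.
Qed.

(** The Mills ratio [Phi / phi], seen from the left tail. As a product it can
    be differentiated directly. *)
Definition mills x : R := Num.sqrt (2 * pi) * expR (x ^+ 2 / 2) * Phi x.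

Lemma millsE x : mills x = Phi x / phi x.
Proof.
rewrite /mills /phi invfM invrK mulNr expRN invrK; ring.
Qed.

Lemma is_derive_mills x : is_derive x 1 mills (1 + x * mills x).
Proof.
have H := is_deriveM (is_deriveZ (Num.sqrt (2 * pi) : R)
   (is_derive1_comp (is_derive_expR _) (is_derive_half_sqr x))) (is_derive_Phi x).
apply: (is_derive_eq H); rewrite /= /GRing.scale /= /mills /phi.
have -> : - x ^+ 2 / 2 = - (x ^+ 2 / 2) by rewrite mulNr.
rewrite expRN; field.
by rewrite !gt_eqF ?expR_gt0 ?sqrt2pi_gt0.
Qed.

Lemma phiN x : phi (- x) = phi x.
Proof. by rewrite /phi sqrrN. Qed.

Lemma is_derive_PhiN x : is_derive x 1 (fun y : R => Phi (- y)) (- phi x).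
Proof.
have H := is_derive1_comp (is_derive_Phi (- x)) (is_deriveNid x (1 : R)).
by apply: (is_derive_eq H); rewrite phiN mulrN mulr1.
Qed.

Lemma cvg_PhiN_pinfty : Phi (- x) @[x --> +oo] --> (0 : R).
Proof.
by have := @cvg_Phi_ninfty R; rewrite cvgNy_compNP.
Qed.

(** The function [Phi x + Phi (- x)] has derivative zero and limit [1]. *)
Lemma PhiN x : Phi (- x) = 1 - Phi x.
Proof.
have cst y : Phi y + Phi (- y) = Phi x + Phi (- x) :> R.
  apply: (@is_derive_0_is_cst R (fun z => Phi z + Phi (- z))) => z.
  have H := is_deriveD (is_derive_Phi z) (is_derive_PhiN z).
  by apply: (is_derive_eq H); rewrite subrr.
have : Phi y + Phi (- y) @[y --> +oo] --> (1 + 0 : R).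
  by apply: cvgD; [exact: cvg_Phi_pinfty|exact: cvg_PhiN_pinfty].
under eq_fun do rewrite cst.
move=> /cvg_lim; rewrite lim_cst // addr0 => <- //.
by rewrite addrAC subrr add0r.
Qed.

(** The Mills ratio bound: [phi y - x Phi (- y)] is nonincreasing for [y >= x]
    and tends to [0]. *)
Lemma mills_bound x : 0 < x -> x * mills (- x) <= 1.
Proof.
move=> x0; rewrite millsE phiN mulrA ler_pdivrMr ?phi_gt0 // mul1r.
pose g y := phi y - x * Phi (- y) : R.
have dg y : is_derive y 1 g ((x - y) * phi y).
  have H := is_deriveB (is_derive_phi y) (is_deriveZ x (is_derive_PhiN y)).
  by apply: (is_derive_eq H); rewrite /GRing.scale /=; ring.
have gx y : x <= y -> - (x * Phi (- y)) <= phi x - x * Phi (- x).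
  move=> xy; have cg : {within `[x, y], continuous g}.
    by apply: derivable_within_continuous => z _.
  have [c] := MVT_segment xy (fun z _ => dg z) cg.
  rewrite in_itv /= => /andP[xc _] e.
  have : g y - g x <= 0.
    rewrite e -mulrA mulr_le0_ge0 ?subr_le0 // mulr_ge0 ?subr_ge0 //.
    by rewrite ltW ?phi_gt0.
  rewrite subr_le0 => /(le_trans _); apply.
  by rewrite /g lerDr ltW ?phi_gt0.
rewrite -subr_ge0 leNgt; apply/negP => neg.
set e := phi x - _ in gx neg.
have e0 : 0 < - e / x by rewrite divr_gt0 // oppr_gt0.
have /cvgrPdist_lt /(_ _ e0) := cvg_PhiN_pinfty.
case=> M [_ HM]; pose y := Num.max x (M + 1).
have xy : x <= y by rewrite le_max lexx.
have /HM /= : M < y by rewrite lt_max ltrDl ltr01 orbT.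
rewrite sub0r normrN ger0_norm ?Phi_ge0 // ltr_pdivlMr // => h.
have := gx _ xy; rewrite leNgt => /negP; apply.
by rewrite ltrNr mulrC.
Qed.

End Mills.

(** * Stein's equation *)

Section Stein.
Variable R : realType.
Implicit Types x y z w u v a h : R.

Lemma le_Phi x y : x <= y -> Phi x <= Phi y.
Proof.
move=> xy; rewrite !Phi_normal fine_le ?fin_num_measure //.
by apply: le_measure; rewrite ?inE //; exact: subset_itvl.
Qed.

Lemma mills_ge0 x : 0 <= mills x.
Proof. by rewrite millsE divr_ge0 ?Phi_ge0 // ltW ?phi_gt0. Qed.

(** A bound for [mills] on the negative half-line: [mills_bound] gives [1] below
    [-1], and [Phi <= 1] gives the second term above [-1]. *)
Definition mills_max : R := 1 + Num.sqrt (2 * pi) * expR 2^-1.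

Lemma mills_max_ge0 : 0 <= mills_max.
Proof. by rewrite addr_ge0 // mulr_ge0 ?expR_ge0 // sqrtr_ge0. Qed.

Lemma mills_norm_bound x : x <= 0 -> `|x| * mills x <= 1.
Proof.
rewrite le_eqVlt => /orP[/eqP->|x0]; first by rewrite normr0 mul0r.
by rewrite ltr0_norm // -[X in mills X]opprK mills_bound // oppr_gt0.
Qed.

Lemma mills_le_max x : x <= 0 -> mills x <= mills_max.
Proof.
move=> x0; have [x1|x1] := leP x (-1).
  apply: (@le_trans _ _ 1); last first.
    by rewrite lerDl mulr_ge0 ?expR_ge0 // sqrtr_ge0.
  apply: le_trans (mills_norm_bound x0).
  by rewrite ler_peMl ?mills_ge0 // ler0_norm // lerNr.
apply: (@le_trans _ _ (Num.sqrt (2 * pi) * expR 2^-1)); last by rewrite lerDr.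
rewrite -[leRHS]mulr1 ler_pM ?Phi_ge0 ?Phi_le1 ?mulr_ge0 ?expR_ge0 ?sqrtr_ge0 //.
rewrite ler_wpM2l ?sqrtr_ge0 // ler_expR -[leRHS]mul1r ler_wpM2r //.
by rewrite -sqrrN expr_le1 // ?oppr_ge0 // lerNl ltW.
Qed.

(** The two branches of [exp(w^2/2)] times the integral of
    [(1(t <= z) - Phi z) exp(-t^2/2)] over [t <= w]: both are solutions of
    Stein's equation on their own side of [z]. *)
Definition stein_left z w : R := mills w * (1 - Phi z).
Definition stein_right z w : R := mills (- w) * Phi z.

Lemma stein_leftN z w : stein_left (- z) (- w) = stein_right z w.
Proof. by rewrite /stein_left PhiN opprB addrC subrK. Qed.

(** For negative [w] these are the Mills ratio bounds. For positive [w] the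
    factor [1 - Phi z] is at most [1 - Phi w], which turns the right-hand side
    into the Mills ratio at [- w]. *)
Lemma stein_left_bound z w : w <= z ->
  0 <= stein_left z w <= mills_max /\ `|w * stein_left z w| <= 1.
Proof.
move=> wz.
have L0 : 0 <= stein_left z w by rewrite mulr_ge0 ?mills_ge0 // subr_ge0 Phi_le1.
have L1 : stein_left z w <= mills w.
  by rewrite ler_piMr ?mills_ge0 // gerBl Phi_ge0.
have L2 : stein_left z w <= mills (- w).
  rewrite /stein_left !millsE phiN PhiN mulrAC ler_wpM2r ?invr_ge0 ?(ltW (phi_gt0 _)) //.
  rewrite -[leRHS]mul1r ler_pM ?Phi_ge0 ?Phi_le1 ?subr_ge0 ?Phi_le1 //.
  by rewrite lerB ?le_Phi.
rewrite normrM (ger0_norm L0) L0 /=.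
have [w0|/ltW w0] := leP w 0; split.
- exact: le_trans (mills_le_max w0).
- by apply: le_trans (mills_norm_bound w0); rewrite ler_wpM2l.
- by apply: (le_trans L2); apply: mills_le_max; rewrite oppr_le0.
- rewrite -normrN; apply: le_trans (@mills_norm_bound (- w) _).
    by rewrite ler_wpM2l.
  by rewrite oppr_le0.
Qed.

Lemma stein_right_bound z w : z <= w ->
  0 <= stein_right z w <= mills_max /\ `|w * stein_right z w| <= 1.
Proof.
move=> zw; have [] := @stein_left_bound (- z) (- w); first by rewrite lerN2.
by rewrite stein_leftN mulNr normrN.
Qed.

Lemma is_derive_stein_left z w :
  is_derive w 1 (stein_left z) (w * stein_left z w + (1 - Phi z)).
Proof.
have H := is_deriveZ (1 - Phi z) (is_derive_mills w).
have E : stein_left z = (1 - Phi z) \*: @mills R.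
  by apply/funext => y; rewrite /stein_left mulrC.
rewrite [X in is_derive _ _ X _]E; apply: (is_derive_eq H).
by rewrite /GRing.scale /= /stein_left; ring.
Qed.

Lemma is_derive_stein_right z w :
  is_derive w 1 (stein_right z) (w * stein_right z w + - Phi z).
Proof.
have H := is_deriveZ (Phi z)
  (is_derive1_comp (is_derive_mills (- w)) (is_deriveNid w (1 : R))).
have E : stein_right z = Phi z \*: (@mills R \o -%R).
  by apply/funext => y; rewrite /stein_right mulrC.
rewrite [X in is_derive _ _ X _]E; apply: (is_derive_eq H).
by rewrite /GRing.scale /= /stein_right; ring.
Qed.

(** Each branch satisfies [S' w = w * S w + kappa]. Boundedness of [S w] and
    [w * S w] makes [S] Lipschitz, and makes [w * S w], hence [S'], Lipschitz
    with a constant that grows linearly in [w]. *)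
Section Branch.
Variables (S : R -> R) (kappa K A u v : R).
Hypothesis dS : forall w, is_derive w 1 S (w * S w + kappa).
Hypothesis S_le : forall w, u <= w <= v -> `|S w| <= K.
Hypothesis wS_le : forall w, u <= w <= v -> `|w * S w| <= 1.
Hypothesis w_le : forall w, u <= w <= v -> `|w| <= A.
Hypothesis kappa_le : `|kappa| <= 1.

Let dS_le w : u <= w <= v -> `|w * S w + kappa| <= 2.
Proof. by move=> h; apply: (le_trans (ler_normD _ _)); rewrite lerD // wS_le. Qed.

Lemma stein_branch_lip : u <= v -> `|S v - S u| <= 2 * (v - u).
Proof.
move=> uv; have cS : {within `[u, v], continuous S}.
  by apply: derivable_within_continuous => z _.
have [c] := MVT_segment uv (fun z _ => dS z) cS.
rewrite in_itv /= => uc ->.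
by rewrite normrM (@ger0_norm _ (v - u)) ?subr_ge0 // ler_wpM2r ?subr_ge0 // dS_le.
Qed.

Lemma stein_branch_lipM w : u <= w <= v ->
  `|w * S w - u * S u| <= (K + 2 * A) * (w - u).
Proof.
case/andP=> uw wv; pose g := fun y : R => y * S y.
have dg y : is_derive y 1 g (S y + y * (y * S y + kappa)).
  have H := is_deriveM (is_derive_id y (1 : R)) (dS y).
  by apply: (is_derive_eq H); rewrite /GRing.scale /=; ring.
have cg : {within `[u, w], continuous g}.
  by apply: derivable_within_continuous => z _.
have [c] := MVT_segment uw (fun z _ => dg z) cg.
rewrite in_itv /= => /andP[uc cw] ->.
have cuv : u <= c <= v by rewrite uc (le_trans cw).
rewrite normrM (@ger0_norm _ (w - u)) ?subr_ge0 // ler_wpM2r ?subr_ge0 //.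
apply: (le_trans (ler_normD _ _)); rewrite lerD ?S_le // normrM mulrC.
by rewrite ler_pM // ?dS_le ?w_le.
Qed.

Lemma stein_branch_taylor : u <= v ->
  `|S v - S u - (v - u) * (u * S u + kappa)| <= (K + 2 * A) * (v - u) ^+ 2.
Proof.
move=> uv; have cS : {within `[u, v], continuous S}.
  by apply: derivable_within_continuous => z _.
have [c] := MVT_segment uv (fun z _ => dS z) cS.
rewrite in_itv /= => uc ->.
have -> : (c * S c + kappa) * (v - u) - (v - u) * (u * S u + kappa) =
  (c * S c - u * S u) * (v - u) by ring.
have /andP[uc' cv] := uc.
rewrite normrM (@ger0_norm _ (v - u)) ?subr_ge0 // expr2 mulrA.
rewrite ler_wpM2r ?subr_ge0 //; apply: (le_trans (stein_branch_lipM uc)).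
have uuv : u <= u <= v by rewrite lexx.
have KA : 0 <= K + 2 * A.
  rewrite addr_ge0 // ?mulr_ge0 //; [exact: le_trans (S_le uuv)|].
  exact: le_trans (w_le uuv).
by rewrite ler_wpM2l // lerB.
Qed.

End Branch.

(** The bounded solution of Stein's equation
    [f' w - w f w = 1(w <= z) - Phi z]. At [z], where it has a corner,
    [stein_deriv] takes the value of the left branch. *)
Definition stein_sol z w : R :=
  if w <= z then stein_left z w else stein_right z w.
Definition stein_deriv z w : R :=
  w * stein_sol z w + ((w <= z)%R%:R - Phi z).

Lemma stein_glue z : stein_left z z = stein_right z z.
Proof.
rewrite /stein_left /stein_right !millsE phiN !PhiN; ring.
Qed.

(** A Lipschitz constant for [w * stein_sol z w] on [[w, w + h]] with [h <= 1],
    where [|w| + 1] bounds the abscissae. *)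
Definition stein_lip w : R := mills_max + 2 * (`|w| + 1).

(** The increments of the solution over a short step [[w, w + h]]. If the step
    crosses [z], it is cut at [z], and the jump of the derivative adds [1]. *)
Section Step.
Variables (z w h : R).
Hypothesis h01 : 0 <= h <= 1.

Let h0 : 0 <= h. Proof. by case/andP: h01. Qed.
Let wwh : w <= w + h. Proof. by rewrite lerDl. Qed.

Let w_le y : w <= y <= w + h -> `|y| <= `|w| + 1.
Proof.
move=> /andP[wy yh]; rewrite -[y](subrK w) addrC.
apply: (le_trans (ler_normD _ _)); rewrite lerD // ger0_norm ?subr_ge0 //.
by rewrite lerBlDl; apply: (le_trans yh); rewrite lerD // ; case/andP: h01.
Qed.

Let kL : `|1 - Phi z| <= 1.
Proof. by rewrite ger0_norm ?subr_ge0 ?Phi_le1 // gerBl Phi_ge0. Qed.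
Let kR : `|- Phi z| <= 1.
Proof. by rewrite normrN ger0_norm ?Phi_ge0 ?Phi_le1. Qed.

Let L1 v : v <= z -> forall y, w <= y <= v -> `|stein_left z y| <= mills_max.
Proof.
move=> vz y /andP[_ yv]; have [/andP[a b] _] := stein_left_bound (le_trans yv vz).
by rewrite ger0_norm.
Qed.
Let L2 v : v <= z -> forall y, w <= y <= v -> `|y * stein_left z y| <= 1.
Proof.
by move=> vz y /andP[_ yv]; have [] := stein_left_bound (le_trans yv vz).
Qed.
Let R1 u : z <= u -> forall y, u <= y <= w + h -> `|stein_right z y| <= mills_max.
Proof.
move=> zu y /andP[uy _]; have [/andP[a b] _] := stein_right_bound (le_trans zu uy).
by rewrite ger0_norm.
Qed.
Let R2 u : z <= u -> forall y, u <= y <= w + h -> `|y * stein_right z y| <= 1.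
Proof.
by move=> zu y /andP[uy _]; have [] := stein_right_bound (le_trans zu uy).
Qed.

Let cross : R := (w <= z < w + h)%R%:R.

Variant step_spec : R -> Type :=
| StepLeft of w + h <= z : step_spec 0
| StepRight of z < w : step_spec 0
| StepCross of w <= z & z < w + h : step_spec 1.

Let stepP : step_spec cross.
Proof.
rewrite /cross; have [wz|zw] /= := leP w z; last exact: StepRight.
by have [zwh|wzh] := ltP z (w + h); [exact: StepCross|exact: StepLeft].
Qed.

Let solL y : y <= z -> stein_sol z y = stein_left z y.
Proof. by rewrite /stein_sol => ->. Qed.
Let solR y : z <= y -> stein_sol z y = stein_right z y.
Proof.
rewrite /stein_sol; case: (ltgtP y z) => // -> _; exact: stein_glue.
Qed.

Lemma stein_sol_lip : `|stein_sol z (w + h) - stein_sol z w| <= 2 * h.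
Proof.
have E : h = (w + h) - w by rewrite addrC addKr.
case: stepP => [whz|zw|wz zwh].
- rewrite !solL // ?(le_trans wwh) // [X in 2 * X]E.
  exact: (stein_branch_lip (is_derive_stein_left z) (L2 whz) kL wwh).
- have zw' := ltW zw.
  rewrite !solR // ?(le_trans zw') // [X in 2 * X]E.
  exact: (stein_branch_lip (is_derive_stein_right z) (R2 zw') kR wwh).
- have zwh' := ltW zwh.
  have := stein_branch_lip (is_derive_stein_left z) (L2 (lexx z)) kL wz.
  have := stein_branch_lip (is_derive_stein_right z) (R2 (lexx z)) kR zwh'.
  rewrite -(solR (lexx z)) -(solR zwh') -(solL (lexx z)) -(solL wz) => H1 H2.
  have -> : stein_sol z (w + h) - stein_sol z w =
   (stein_sol z (w + h) - stein_sol z z) + (stein_sol z z - stein_sol z w) by ring.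
  apply: (le_trans (ler_normD _ _)); apply: (le_trans (lerD H1 H2)).
  by rewrite -mulrDr addrA subrK -E.
Qed.

Let K0 : 0 <= stein_lip w.
Proof. by rewrite addr_ge0 ?mills_max_ge0 // mulr_ge0 // addr_ge0. Qed.

Lemma stein_deriv_lip :
  `|stein_deriv z (w + h) - stein_deriv z w| <= stein_lip w * h + cross.
Proof.
have E : h = (w + h) - w by rewrite addrC addKr.
rewrite /stein_deriv.
have -> : forall a b c d e : R, a + (b - c) - (d + (e - c)) = (a - d) + (b - e).
  by move=> *; ring.
case: stepP => [whz|zw|wz zwh].
- have wz := le_trans wwh whz; rewrite whz wz subrr !addr0 !solL // [X in stein_lip w * X]E.
  apply: (stein_branch_lipM (is_derive_stein_left z) (L1 whz) (L2 whz) w_le kL).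
  by rewrite wwh lexx.
- have zw' := ltW zw; have zwh := lt_le_trans zw wwh.
  rewrite (leNgt w) (leNgt (w + h)) zw zwh subrr !addr0 !solR // ?(ltW zwh) // [X in stein_lip w * X]E.
  apply: (stein_branch_lipM (is_derive_stein_right z) (R1 zw') (R2 zw') w_le kR).
  by rewrite wwh lexx.
- have zwh' := ltW zwh; rewrite wz (leNgt (w + h)) zwh /= sub0r.
  apply: (le_trans (ler_normD _ _)); rewrite normrN normr1 lerD //.
  have wl y : w <= y <= z -> `|y| <= `|w| + 1.
    by case/andP=> wy yz; apply: w_le; rewrite wy (le_trans yz).
  have wr y : z <= y <= w + h -> `|y| <= `|w| + 1.
    by case/andP=> zy yz; apply: w_le; rewrite yz (le_trans wz).
  have H2 : `|z * stein_left z z - w * stein_left z w| <= stein_lip w * (z - w).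
    apply: (stein_branch_lipM (is_derive_stein_left z) (L1 (lexx z))
       (L2 (lexx z)) wl kL).
    by rewrite wz lexx.
  have H1 : `|(w + h) * stein_right z (w + h) - z * stein_right z z| <=
       stein_lip w * (w + h - z).
    apply: (stein_branch_lipM (is_derive_stein_right z) (R1 (lexx z))
       (R2 (lexx z)) wr kR).
    by rewrite zwh' lexx.
  rewrite (solR zwh') (solL wz).
  rewrite -[X in `|X|](subrKA (z * stein_left z z)) {1}stein_glue.
  apply: (le_trans (ler_normD _ _)); apply: (le_trans (lerD H1 H2)).
  by rewrite -mulrDr addrA subrK -E.
Qed.

Lemma stein_sol_le : `|w * stein_sol z w| <= 1.
Proof.
have [wz|/ltW zw] := leP w z; first by rewrite solL //; case: (stein_left_bound wz).
by rewrite solR //; case: (stein_right_bound zw).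
Qed.

(** A crossing step has no second-order expansion: the Lipschitz bound [2 h] for
    the increment and the bound [2] for the derivative give the term [4 h]. *)
Lemma stein_sol_taylor :
  `|stein_sol z (w + h) - stein_sol z w - h * stein_deriv z w| <=
    h * (stein_lip w * h + 4 * cross).
Proof.
have E : h = (w + h) - w by rewrite addrC addKr.
have cross_le : 0 <= cross by rewrite /cross ler0n.
have D2 : `|stein_deriv z w| <= 2.
  apply: (le_trans (ler_normD _ _)).
  rewrite -[leRHS]/(1 + 1 : R) lerD ?stein_sol_le //.
  by case: (w <= z); rewrite // ?sub0r.
case: stepP => [whz|zw|wz zwh].
- have wz := le_trans wwh whz; rewrite /stein_deriv wz mulr0 addr0 !solL //.
  rewrite [leRHS](_ : _ = stein_lip w * (w + h - w) ^+ 2); last by rewrite -E; ring.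
  rewrite [X in X * (_ + _)]E.
  exact: (stein_branch_taylor (is_derive_stein_left z) (L1 whz) (L2 whz) w_le kL).
- have zw' := ltW zw; have zwh := le_trans zw' wwh.
  rewrite /stein_deriv (leNgt w) zw sub0r mulr0 addr0 !solR //.
  rewrite [leRHS](_ : _ = stein_lip w * (w + h - w) ^+ 2); last by rewrite -E; ring.
  rewrite [X in X * (_ + _)]E.
  exact: (stein_branch_taylor (is_derive_stein_right z) (R1 zw') (R2 zw') w_le kR).
- apply: (le_trans (ler_normB _ _)).
  apply: (@le_trans _ _ (2 * h + h * 2)).
    apply: lerD; first exact: stein_sol_lip.
    by rewrite normrM ger0_norm // ler_wpM2l.
  rewrite [leLHS](_ : _ = h * 4); last by ring.
  by rewrite ler_wpM2l // mulr1 lerDr mulr_ge0.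
Qed.

End Step.

End Stein.

(** * Normal approximation of Bernoulli sums *)

Section Kolmogorov.
Variable R : realType.

(** Replacing the derivative by the slope contributes [mills_max + 10], and the
    second difference [3 mills_max + 49 / 2]. *)
Definition pb_const : R := 4 * mills_max R + 35.

Variables (rs : seq R) (s a : R).
Hypotheses (rs01 : all (@in01 R) rs) (s1 : 1 <= s) (sV : s ^+ 2 = pbvar rs).

Let mu := pbmean rs.
Let h : R := s^-1.
Let z := (a - mu) * h.
Let w (k : nat) : R := (k%:R - mu) * h.
(* The solution of Stein's equation is sampled at the standardised integers.
   Its slope [D] over a step of length [h] approximates the derivative [G]. *)
Let f (k : nat) : R := stein_sol z (w k).
Let G (k : nat) : R := stein_deriv z (w k).
Let D (k : nat) : R := s * fdiff f k.
Let B (k : nat) : R := stein_lip (w k).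

Let s0 : 0 < s. Proof. exact: lt_le_trans s1. Qed.
Let h0 : 0 < h. Proof. by rewrite invr_gt0. Qed.
Let sh : s * h = 1. Proof. by rewrite divff // gt_eqF. Qed.
Let h1 : h <= 1. Proof. by rewrite invf_le1. Qed.
Let h01 : 0 <= h <= 1. Proof. by rewrite h1 ltW. Qed.
Let wS k : w k.+1 = w k + h.
Proof. by rewrite /w -natr1; ring. Qed.

Let crossE k : ((w k <= z < w k + h)%R%:R : R) = jump a k.
Proof.
by rewrite -wS /w /z /jump ler_pM2r // ltr_pM2r // lerBlDr subrK ltrBrDr subrK.
Qed.

Let e k : R := B k * h + 4 * jump a k.

Let D_G k : `|D k - G k| <= e k.
Proof.
have := stein_sol_taylor z (w k) h01.
rewrite crossE -wS -/(f k) -/(f k.+1) -/(G k) -/(B k) -/(fdiff f k) => H.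
have -> : D k - G k = s * (fdiff f k - h * G k) by rewrite mulrBr mulrA sh mul1r.
rewrite normrM (gtr0_norm s0) -[leRHS]mul1r -sh -mulrA.
by rewrite ler_wpM2l // ltW.
Qed.

Let normwS k : `|w k.+1| <= `|w k| + h.
Proof. by rewrite wS; apply: (le_trans (ler_normD _ _)); rewrite (gtr0_norm h0). Qed.

Let diffD k : `|fdiff D k| <=
  (3 * (mills_max R + 2) + 2) * h + 6 * h * `|w k| +
  (5 * jump a k + 4 * jump (a - 1) k).
Proof.
have H1 := D_G k; have H2 := D_G k.+1.
have := stein_deriv_lip z (w k) h01.
rewrite crossE -wS -/(G k) -/(G k.+1) -/(B k) => H3.
have -> : fdiff D k = (D k.+1 - G k.+1) + (G k.+1 - G k) - (D k - G k).
  by rewrite /fdiff; ring.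
apply: (le_trans (ler_normB _ _)).
apply: (le_trans (lerD (ler_normD _ _) (lexx _))).
apply: (le_trans (lerD (lerD H2 H3) H1)).
rewrite /e; have -> : jump a k.+1 = jump (a - 1) k.
  by rewrite /jump -!natr1 lerBrDr ltrBlDr.
have : B k.+1 * h <= (B k + 2) * h.
  rewrite ler_wpM2r ?(ltW h0) // /B /stein_lip.
  by have := normwS k; have := h1; lra.
rewrite /B /stein_lip; set j1 := jump a k; set j2 := jump _ k.
set x := stein_lip _ * h.
lra.
Qed.

Let absw : pbexp rs (fun k => `|w k|) <= 1.
Proof.
rewrite (@eq_pbexp _ _ _ (fun k => h * `|k%:R - mu|)); last first.
  by move=> k; rewrite /w normrM (gtr0_norm h0) mulrC.
rewrite pbexpZ -[leRHS]sh mulrC ler_wpM2r ?(ltW h0) //.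
exact: pbexp_abs_dev.
Qed.

Let stein_absw : pbstein rs (fun k => `|w k|) <= 2 * s ^+ 2.
Proof.
have := pbstein_pbexp (fun k => `|w k|) rs01; rewrite -sV => H.
have H' : pbstein rs (fun k => `|fdiff (fun k => `|w k|) k|) <= 1 * s ^+ 2.
  rewrite sV -pbstein_cst; apply: le_pbstein => // k; rewrite /fdiff.
  apply: (le_trans (ler_dist_dist _ _)).
  by rewrite wS addrC addKr (gtr0_norm h0).
have := le_trans (ler_norm _) (le_trans H H').
have : s ^+ 2 * pbexp rs (fun k => `|w k|) <= s ^+ 2 * 1.
  by rewrite ler_wpM2l ?sqr_ge0.
lra.
Qed.

(* The concentration bound concerns the variables [S - B_i]; it extends to [S]
   because [S] and [S - B_i] differ by at most one. *)
Let exp_jump : pbexp rs (jump a) <= 3 / 2 * h.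
Proof.
have := pbstein_pbexp (jump a) rs01; rewrite -sV => H.
have H' : pbstein rs (fun k => `|fdiff (jump a) k|) <= s.
  apply: (@le_trans _ _ (pbstein rs (fun k => jump (a - 1) k + jump a k))).
    apply: le_pbstein => // k; apply: (le_trans (ler_normB _ _)).
    rewrite !ger0_norm ?jump_ge0 // lerD //.
    by rewrite /jump -!natr1 lerBrDr ltrBlDr.
  rewrite pbsteinD [leRHS](splitr s) lerD //; exact: pbstein_jump.
rewrite distrC in H.
have := le_trans (ler_norm _) (le_trans H H').
have := pbstein_jump a rs01 s0 sV.
move=> H1 H2; have : s ^+ 2 * pbexp rs (jump a) <= 3 / 2 * s by lra.
rewrite mulrC -ler_pdivlMr ?exprn_gt0 // => /le_trans; apply.
by rewrite /h expr2 invfM mulrA mulfK // gt_eqF.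
Qed.

Let stein_diffD : pbstein rs (fun k => `|fdiff D k|) <=
  (3 * mills_max R + 49 / 2) * s.
Proof.
apply: le_trans (le_pbstein rs01 diffD) _.
rewrite !pbsteinD pbstein_cst -sV !pbsteinZ.
have J1 := pbstein_jump a rs01 s0 sV.
have J2 := pbstein_jump (a - 1) rs01 s0 sV.
have : 6 * h * pbstein rs (fun k => `|w k|) <= 6 * h * (2 * s ^+ 2).
  by rewrite ler_wpM2l // mulr_ge0 ?(ltW h0).
have -> : 6 * h * (2 * s ^+ 2) = 12 * s * (s * h) by ring.
set m := mills_max R.
have -> : (3 * (m + 2) + 2) * h * s ^+ 2 = (3 * (m + 2) + 2) * s * (s * h) by ring.
rewrite !sh.
lra.
Qed.

(** By the Stein equation, [1(k <= a) - Phi z] is [G k - w k * f k]. Replacing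
    [G] by [D] costs [O(h)] in expectation, and by the Stein identity what
    remains is the difference between [pbvar] times [pbexp] and [pbstein],
    which the second difference of [f] controls. *)
Lemma pb_kolmogorov :
  `|pbexp rs (fun k => (k%:R <= a)%R%:R) - Phi ((a - pbmean rs) / s)|
    <= pb_const / s.
Proof.
rewrite -/mu -/h -/z.
have ew k : (k%:R <= a) = (w k <= z).
  by rewrite /w /z ler_pM2r // lerBlDr subrK.
have E : pbexp rs (fun k => (k%:R <= a)%R%:R) - Phi z =
  pbexp rs (fun k => G k - D k) +
    h ^+ 2 * (s ^+ 2 * pbexp rs D - pbstein rs D).
  have hs2 : h ^+ 2 * s ^+ 2 = 1 by rewrite -exprMn mulrC sh expr1n.
  have -> : pbstein rs D = s ^+ 2 * pbexp rs (fun k => w k * f k).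
    rewrite pbsteinZ -pbexp_stein expr2 -mulrA -[s * pbexp rs (fun k => w k * f k)]pbexpZ; congr (_ * _).
    apply: eq_pbexp => k; rewrite /w -/mu mulrA; congr (_ * _).
    by rewrite mulrCA sh mulr1.
  rewrite mulrBr !(mulrA (h ^+ 2) (s ^+ 2)) hs2 !mul1r pbexpB.
  rewrite subrKA -pbexpB -[Phi z](pbexp_cst rs) -pbexpB.
  apply: eq_pbexp => k; rewrite ew /G /stein_deriv -/(f k); ring.
rewrite E; apply: (le_trans (ler_normD _ _)).
have T1 : `|pbexp rs (fun k => G k - D k)| <= (mills_max R + 10) * h.
  apply: (le_trans (ler_norm_pbexp rs01 _)).
  apply: (@le_trans _ _ (pbexp rs e)).
    by apply: le_pbexp => // k; rewrite distrC.
  rewrite (@eq_pbexp _ _ e (fun k => (mills_max R + 2) * h +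
     (2 * h * `|w k| + 4 * jump a k))); last first.
    by move=> k; rewrite /e /B /stein_lip; ring.
  rewrite !pbexpD pbexp_cst !pbexpZ.
  have : 2 * h * pbexp rs (fun k => `|w k|) <= 2 * h * 1.
    by rewrite ler_wpM2l // mulr_ge0 ?(ltW h0).
  have := exp_jump; set m := mills_max R; lra.
have T2 : `|h ^+ 2 * (s ^+ 2 * pbexp rs D - pbstein rs D)| <=
    (3 * mills_max R + 49 / 2) * h.
  rewrite normrM (ger0_norm (sqr_ge0 _)) distrC sV.
  apply: (@le_trans _ _ (h ^+ 2 * ((3 * mills_max R + 49 / 2) * s))).
    rewrite ler_wpM2l ?sqr_ge0 //.
    exact: le_trans (pbstein_pbexp D rs01) stein_diffD.
  have -> : h ^+ 2 * ((3 * mills_max R + 49 / 2) * s) =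
    (3 * mills_max R + 49 / 2) * h * (s * h) by ring.
  by rewrite sh mulr1.
apply: (le_trans (lerD T1 T2)).
rewrite -mulrDl ler_wpM2r ?(ltW h0) // /pb_const; set m := mills_max R; lra.
Qed.

End Kolmogorov.

(** * Descents in a sequence of coins *)

(** With the default [true], a final head is not a descent. *)
Fixpoint descents (s : seq bool) : nat :=
  if s is b :: s' then ((b && ~~ head true s') + descents s')%N else 0%N.

(** The expectation of [f] over [n] independent tosses with probability [p] of
    [true]. The ring is arbitrary so that generating functions are expectations
    with values in the ring of polynomials. *)
Fixpoint coinexp (A : pzRingType) (p : A) (n : nat) (f : seq bool -> A) : A :=
  if n is n'.+1 then
    (1 - p) * coinexp p n' (fun s => f (false :: s))
    + p * coinexp p n' (fun s => f (true :: s))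
  else f [::].

(** The sum over [j] of ['C(n - j, j) (- X)^j], a Fibonacci polynomial read in
    reverse order. *)
Fixpoint fibpoly (A : nzRingType) (n : nat) : {poly A} :=
  if n is n'.+1 then
    if n' is n''.+1 then fibpoly A n' - 'X * fibpoly A n'' else 1
  else 1.

Lemma fibpolySS (A : nzRingType) n :
  fibpoly A n.+2 = fibpoly A n.+1 - 'X * fibpoly A n.
Proof. by []. Qed.

Lemma nat_ind2 (Q : nat -> Prop) :
  Q 0%N -> Q 1%N -> (forall n, Q n -> Q n.+1 -> Q n.+2) -> forall n, Q n.
Proof.
move=> Q0 Q1 QS n; suff [] : Q n /\ Q n.+1 by [].
by elim: n => [|n [Qn QSn]]; split => //; exact: QS.
Qed.

Section Fib.
Variable R : realType.
Implicit Types (t p x : R) (ts : seq R).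

Local Notation U := (fibpoly R).

Lemma size_fibpoly n : (size (U n) <= n./2.+1)%N.
Proof.
elim/nat_ind2: n => [||n IH0 IH1]; rewrite ?size_poly1 // fibpolySS.
apply: (leq_trans (size_polyD _ _)); rewrite geq_max size_polyN; apply/andP; split.
  by apply: (leq_trans IH1); lia.
by apply: (leq_trans (size_polyMleq _ _)); rewrite size_polyX; lia.
Qed.

Lemma fibpoly0 n : (U n).[0] = 1.
Proof.
elim/nat_ind2: n => [||n IH0 IH1]; rewrite ?hornerC //.
by rewrite fibpolySS hornerD hornerN hornerM hornerX mul0r subr0.
Qed.

(** Both sides satisfy the recursion of [sin (n theta)]: up to normalisation,
    [fibpoly n] is a Chebyshev polynomial of the second kind. *)
Lemma fibpoly_trig n (theta : R) : cos theta != 0 ->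
  (U n).[(4 * cos theta ^+ 2)^-1] * (2 * cos theta) ^+ n * sin theta =
  sin (n.+1%:R * theta).
Proof.
move=> c0; elim/nat_ind2: n => [||n IH0 IH1].
- by rewrite hornerC expr0 !mul1r.
- rewrite hornerC expr1 mul1r (_ : 2 * theta = theta + theta); last by ring.
  by rewrite sinD; ring.
rewrite fibpolySS hornerD hornerN hornerM hornerX.
have -> : sin (n.+3%:R * theta) =
   2 * cos theta * sin (n.+2%:R * theta) - sin (n.+1%:R * theta).
  have -> : n.+3%:R * theta = n.+2%:R * theta + theta by rewrite -natr1; ring.
  have -> : n.+1%:R * theta = n.+2%:R * theta - theta by rewrite -natr1; ring.
  by rewrite sinD sinB; ring.
rewrite -IH0 -IH1 !exprS; field.
by rewrite c0.
Qed.

Definition fib_angle (n k : nat) : R := k.+1%:R * pi / n.+1%:R.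
(** The reciprocals of the roots of [fibpoly n]: they are the coefficients in
    its factorisation, normalised by the constant coefficient [1]. *)
Definition fib_invroot (n k : nat) : R := 4 * cos (fib_angle n k) ^+ 2.
Definition fib_invroots (n : nat) : seq R := map (fib_invroot n) (iota 0 n./2).

Lemma fib_angle_bound n k : (k < n./2)%N -> 0 < fib_angle n k < pi / 2.
Proof.
move=> kn; rewrite /fib_angle; apply/andP; split.
  by rewrite divr_gt0 ?mulr_gt0 ?pi_gt0.
rewrite mulrAC mulrC ltr_pM2l ?pi_gt0 // ltr_pdivrMr // mulrC ltr_pdivlMr //.
by rewrite -natrM ltr_nat; lia.
Qed.

Lemma fib_cos_gt0 n k : (k < n./2)%N -> 0 < cos (fib_angle n k).
Proof.
move=> /fib_angle_bound /andP[a0 a1]; apply: cos_gt0_pihalf.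
by rewrite a1 andbT (lt_trans _ a0) // oppr_lt0 divr_gt0 ?pi_gt0.
Qed.

Lemma fib_invroot_gt0 n k : (k < n./2)%N -> 0 < fib_invroot n k.
Proof. by move=> kn; rewrite mulr_gt0 ?exprn_gt0 // fib_cos_gt0. Qed.

Lemma fibpoly_root n k : (k < n./2)%N -> root (U n) (fib_invroot n k)^-1.
Proof.
move=> kn; have c0 := fib_cos_gt0 kn; have /andP[a0 a1] := fib_angle_bound kn.
have := fibpoly_trig n (lt0r_neq0 c0).
have -> : n.+1%:R * fib_angle n k = k.+1%:R * pi.
  by rewrite /fib_angle mulrC divfK // pnatr_eq0.
have -> : sin (k.+1%:R * pi) = 0 :> R.
  elim: k.+1 => [|m IH]; first by rewrite mul0r sin0.
  by rewrite -natr1 mulrDl mul1r sinDpi IH oppr0.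
move/eqP; rewrite !mulf_eq0 expf_eq0 mulf_eq0 (gt_eqF c0) pnatr_eq0 andbF orbF.
rewrite orbC gt_eqF //=; apply: sin_gt0_pi; rewrite a0 (lt_trans a1) //.
by rewrite ltr_pdivrMr // ltr_pMr ?pi_gt0 // ltr1n.
Qed.

Lemma fib_invroots_uniq n : uniq (map (@GRing.inv R) (fib_invroots n)).
Proof.
rewrite -map_comp map_inj_in_uniq ?iota_uniq // => i j.
rewrite !mem_iota !add0n /= => hi hj /invr_inj.
have ci := fib_cos_gt0 hi; have cj := fib_cos_gt0 hj.
have n4 : 4 != 0 :> R by rewrite pnatr_eq0.
move/(mulfI n4)/eqP; rewrite eqrXn2 ?ltW // => /eqP cij.
have pi2 : pi / 2 < pi :> R by rewrite ltr_pdivrMr // ltr_pMr ?pi_gt0 // ltr1n.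
have in0pi k : (k < n./2)%N -> fib_angle n k \in `[0, pi].
  move=> /fib_angle_bound /andP[k0 k1].
  by rewrite in_itv /= ltW //= ltW // (lt_trans k1).
move: (cos_inj (in0pi _ hi) (in0pi _ hj) cij).
have n1 : n.+1%:R^-1 != 0 :> R by rewrite invr_eq0 pnatr_eq0.
have pi0 : pi != 0 :> R by rewrite gt_eqF ?pi_gt0.
move/(mulIf n1)/(mulIf pi0)/eqP.
by rewrite eqr_nat => /eqP [].
Qed.

Definition factpoly ts : {poly R} := \prod_(t <- ts) (1 - t *: 'X).

Lemma factpoly_cons t ts : factpoly (t :: ts) = (1 - t *: 'X) * factpoly ts.
Proof. by rewrite /factpoly big_cons. Qed.

Lemma size_factpoly ts : (size (factpoly ts) <= (size ts).+1)%N.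
Proof.
elim: ts => [|t ts IH]; first by rewrite /factpoly big_nil size_poly1.
rewrite factpoly_cons; apply: (leq_trans (size_polyMleq _ _)).
have : (size (1 - t *: 'X : {poly R})%R <= 2)%N.
  apply: (leq_trans (size_polyD _ _)); rewrite geq_max size_poly1 size_polyN /=.
  by apply: (leq_trans (size_scale_leq _ _)); rewrite size_polyX.
by move=> H; rewrite -subn1 leq_subLR; exact: leq_add H IH.
Qed.

(** Both sides have degree at most [n / 2]; they agree at the [n / 2] roots and
    at [0]. *)
Lemma fibpoly_fact n : U n = factpoly (fib_invroots n).
Proof.
apply/eqP; rewrite -subr_eq0; apply/eqP.
apply: (@roots_geq_poly_eq0 _ _ (0 :: map (@GRing.inv R) (fib_invroots n))).
- apply/andP; split.
    rewrite rootE hornerD hornerN fibpoly0 /factpoly horner_prod big1 ?subrr //.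
    by move=> t _; rewrite hornerD hornerN hornerZ hornerX hornerC mulr0 subr0.
  apply/allP => x /mapP[t tn ->]; rewrite rootE hornerD hornerN.
  have [k kn et] : exists2 k, (k < n./2)%N & t = fib_invroot n k.
    by case/mapP: tn => k; rewrite mem_iota /= add0n => kn ->; exists k.
  have /rootP -> : root (U n) t^-1 by rewrite et fibpoly_root.
  have t0 : t != 0 by rewrite et gt_eqF ?fib_invroot_gt0.
  rewrite sub0r oppr_eq0 /factpoly horner_prod (big_rem t) //=.
  by rewrite hornerD hornerN hornerZ hornerX hornerC divff // subrr mul0r.
- rewrite cons_uniq fib_invroots_uniq andbT; apply/negP => /mapP[t].
  case/mapP => k; rewrite mem_iota /= add0n => /fib_invroot_gt0 k0 -> /eqP.
  by rewrite eq_sym invr_eq0 gt_eqF.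
- rewrite /= size_map /fib_invroots size_map size_iota.
  apply: (leq_trans (size_polyD _ _)); rewrite geq_max size_fibpoly size_polyN.
  by apply: (leq_trans (size_factpoly _)); rewrite size_map size_iota.
Qed.

End Fib.

Section Law.
Variable R : realType.
Implicit Types (t p x : R) (ts rs : seq R).
Local Notation U := (fibpoly R).

Lemma coef_factpoly ts :
  [/\ (factpoly ts)`_0 = 1, (factpoly ts)`_1 = - \sum_(t <- ts) t &
      2 * (factpoly ts)`_2 = (\sum_(t <- ts) t) ^+ 2 - \sum_(t <- ts) t ^+ 2].
Proof.
elim: ts => [|t ts [IH0 IH1 IH2]].
  by rewrite /factpoly !big_nil !coefC /=; split; ring.
rewrite factpoly_cons !big_cons mulrBl mul1r -scalerAl !coefB !coefZ !coefXM /=.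
rewrite IH0 IH1 mulrBr IH2; set a := \sum_(_ <- _) _; set b := \sum_(_ <- _) _.
by split; ring.
Qed.

Lemma coef_fibpoly n :
  [/\ (U n)`_0 = 1, (U n.+1)`_1 = - n%:R &
      2 * (U n.+2)`_2 = n%:R * (n%:R - 1)].
Proof.
have c0 m : (U m)`_0 = 1 by rewrite -horner_coef0 fibpoly0.
have c1 m : (U m.+1)`_1 = - m%:R.
  elim: m => [|m IH]; first by rewrite coefC /= oppr0.
  by rewrite fibpolySS coefB coefXM IH /= c0 -natr1; ring.
split=> //; elim: n => [|n IH].
  by rewrite fibpolySS coefB coefXM /= !coefC /=; ring.
by rewrite fibpolySS coefB coefXM mulrBr IH /= c1 -natr1; ring.
Qed.

(** The low-order coefficients of the two forms of [fibpoly] give the power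
    sums without any trigonometric summation. *)
Lemma sum_fib_invroots n :
  \sum_(t <- fib_invroots R n.+2) t = n%:R + 1 /\
  \sum_(t <- fib_invroots R n.+2) t ^+ 2 = 3 * n%:R + 1.
Proof.
have [_ F1 F2] := coef_factpoly (fib_invroots R n.+2).
have [_ C1 _] := coef_fibpoly n.+1; have [_ _ C2] := coef_fibpoly n.
rewrite -fibpoly_fact in F1 F2.
have E1 : \sum_(t <- fib_invroots R n.+2) t = n%:R + 1.
  by apply: oppr_inj; rewrite -F1 C1 -natr1.
split=> //; rewrite E1 C2 in F2.
have -> : \sum_(t <- fib_invroots R n.+2) t ^+ 2 = (n%:R + 1) ^+ 2 - n%:R * (n%:R - 1).
  by rewrite F2; ring.
by ring.
Qed.

Definition descent_params p (n : nat) : seq R :=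
  [seq p * (1 - p) * t | t <- fib_invroots R n].

Section Params.
Variable p : R.
Hypothesis p01 : 0 < p < 1.

Let pq0 : 0 < p * (1 - p).
Proof. by case/andP: p01 => p0 p1; rewrite mulr_gt0 // subr_gt0. Qed.

Let pq4 : 4 * (p * (1 - p)) <= 1.
Proof.
rewrite -subr_ge0; have -> : 1 - 4 * (p * (1 - p)) = (1 - 2 * p) ^+ 2 by ring.
exact: sqr_ge0.
Qed.

(** This is where [4 p (1 - p) <= 1] makes the factors of the generating
    function those of Bernoulli variables. *)
Lemma descent_params01 n : all (@in01 R) (descent_params p n).
Proof.
apply/allP => r /mapP[t /mapP[k _ ->] ->].
rewrite /fib_invroot; have := cos2Dsin2 (fib_angle R n k).
set c := cos _; set s := sin _ => cs.
have c0 : 0 <= c ^+ 2 by rewrite sqr_ge0.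
have c1 : c ^+ 2 <= 1 by rewrite -cs lerDl sqr_ge0.
rewrite /in01; apply/andP; split.
  by rewrite mulr_ge0 ?(ltW pq0) // mulr_ge0.
have -> : p * (1 - p) * (4 * c ^+ 2) = (4 * (p * (1 - p))) * c ^+ 2 by ring.
by rewrite -[leRHS]mulr1 ler_pM // mulr_ge0 // (ltW pq0).
Qed.

(** With [b = p (1 - p)] the variance of the descents in [n + 2] tosses is
    [b (n + 1) - b^2 (3 n + 1)], and [b <= 1 / 4]. *)
Lemma pbvar_descent_params n :
  p * (1 - p) / 4 * n.+2%:R <= pbvar (descent_params p n.+2).
Proof.
have [E1 E2] := sum_fib_invroots n.
rewrite /pbvar /descent_params big_map.
rewrite (eq_bigr (fun t => p * (1 - p) * t - (p * (1 - p)) ^+ 2 * t ^+ 2)); last first.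
  by move=> t _; ring.
rewrite sumrB -!mulr_sumr E1 E2 -[n.+2]addn2 natrD; move: pq0 pq4.
set b := p * (1 - p); set m := n%:R => b0 b4.
have m0 : 0 <= m by rewrite ler0n.
have : b * (3 * m + 1) * (4 * b) <= b * (3 * m + 1) * 1.
  by rewrite ler_wpM2l // mulr_ge0 ?(ltW b0) //; lra.
lra.
Qed.

End Params.

(** * The law of the number of descents *)

(** The linear functional that sends ['X^k] to [f k] for [k < N]. It turns an
    equality of generating functions into an equality of laws. *)
Definition polyfun (N : nat) (f : nat -> R) (P : {poly R}) : R :=
  \sum_(i < N) P`_i * f i.

Lemma polyfunD N f P Q : polyfun N f (P + Q) = polyfun N f P + polyfun N f Q.
Proof.
by rewrite /polyfun -big_split /=; apply: eq_bigr => i _; rewrite coefD mulrDl.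
Qed.

Lemma polyfunC N f a P : polyfun N f (a%:P * P) = a * polyfun N f P.
Proof.
rewrite /polyfun mulr_sumr; apply: eq_bigr => i _.
by rewrite coefCM mulrA.
Qed.

Lemma polyfunX N f k : (k < N)%N -> polyfun N f 'X^k = f k.
Proof.
move=> kN; rewrite /polyfun (bigD1 (Ordinal kN)) //= coefXn eqxx mul1r big1 ?addr0 //.
move=> i ik; rewrite coefXn; case: eqP => [e|_]; last by rewrite mul0r.
by case/eqP: ik; apply: val_inj.
Qed.

Lemma polyfun_coinexp N f p n (g : seq bool -> {poly R}) :
  polyfun N f (coinexp p%:P n g) = coinexp p n (fun s => polyfun N f (g s)).
Proof.
elim: n g => [|n IH] g //=.
by rewrite polyfunD -[1]/(1%:P) -polyCB !polyfunC !IH.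
Qed.

Lemma polyfun_pbexp N f rs (g : nat -> {poly R}) :
  polyfun N f (pbexp (map polyC rs) g) = pbexp rs (fun k => polyfun N f (g k)).
Proof.
elim: rs g => [|r rs IH] g //=.
by rewrite polyfunD -[1]/(1%:P) -polyCB !polyfunC !IH.
Qed.

Lemma eq_in_coinexp (A : pzRingType) (p : A) n (f g : seq bool -> A) :
  (forall s, size s = n -> f s = g s) -> coinexp p n f = coinexp p n g.
Proof.
elim: n f g => [|n IH] f g fg /=; first exact: fg.
by congr (_ * _ + _ * _); apply: IH => s sn; rewrite fg //= sn.
Qed.

Lemma coinexpZ (A : comPzRingType) (p : A) n (f : seq bool -> A) a :
  coinexp p n (fun s => a * f s) = a * coinexp p n f.
Proof.
elim: n f => [|n IH] f //=.
rewrite (IH (fun s => f (false :: s))) (IH (fun s => f (true :: s))) mulrDr.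
by rewrite !(mulrCA a).
Qed.

Lemma eq_in_pbexp rs (f g : nat -> R) :
  (forall k, (k <= size rs)%N -> f k = g k) -> pbexp rs f = pbexp rs g.
Proof.
elim: rs f g => [|r rs IH] f g fg /=; first exact: fg.
by congr (_ * _ + _ * _); apply: IH => k kn; rewrite fg // (leq_trans kn).
Qed.

Lemma descents_size s : (descents s <= size s)%N.
Proof.
elim: s => [|b s IH] //=; rewrite -add1n leq_add //.
by case: (b && _).
Qed.

(** With [A] the generating function and [B] its variant for a sequence preceded
    by a head, conditioning on the first toss expresses the next [A] and [B] by
    the present ones; eliminating [B] gives the recursion of [fibpoly]. *)
Lemma descent_pgf p n :
  coinexp p%:P n (fun s => 'X^(descents s)) =
  U n \Po ((p * (1 - p))%:P * (1 - 'X)).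
Proof.
pose A n := coinexp p%:P n (fun s => 'X^(descents s)).
pose B n := coinexp p%:P n (fun s => 'X^(descents (true :: s))).
have AS m : A m.+1 = (1 - p%:P) * A m + p%:P * B m by [].
have BS m : B m.+1 = (1 - p%:P) * ('X * A m) + p%:P * B m.
  rewrite -[X in _ * X + _](coinexpZ p%:P m (fun s => 'X^(descents s))).
  congr (_ * _ + _ * _).
  by apply: eq_in_coinexp => s _; rewrite /= exprS.
have ASS m : A m.+2 = A m.+1 - (p * (1 - p))%:P * (1 - 'X) * A m.
  rewrite (AS m.+1) BS [in X in _ = _ - X]polyCM polyCB (AS m) polyC1.
  by ring.
rewrite -/(A n); elim/nat_ind2: n => [||n IH0 IH1].
- by rewrite /A /= comp_polyC.
- by rewrite AS comp_polyC /A /B /= !expr0 !mulr1 subrK.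
by rewrite ASS fibpolySS comp_polyB comp_polyM comp_polyX -IH0 -IH1.
Qed.

Lemma pbexp_pgf rs :
  pbexp (map polyC rs) (fun k => 'X^k) = \prod_(r <- rs) (1 - r%:P * (1 - 'X)).
Proof.
elim: rs => [|r rs IH]; first by rewrite big_nil.
rewrite big_cons -IH /=.
pose P : {poly R} := pbexp (map polyC rs) (fun k => 'X^k).
rewrite -/P; have -> : pbexp (map polyC rs) (fun k => 'X^(k.+1)) = 'X * P.
  by rewrite -pbexpZ; apply: eq_pbexp => k; rewrite exprS.
by ring.
Qed.

(** The generating function of the number of descents has only real roots, so
    it is a product of generating functions of Bernoulli variables. *)
Lemma descents_law p n (f : nat -> R) :
  coinexp p n (fun s => f (descents s)) = pbexp (descent_params p n) f.
Proof.
set rs := descent_params p n.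
pose N := (n + size rs).+1.
transitivity (polyfun N f (coinexp p%:P n (fun s => 'X^(descents s)))).
  rewrite polyfun_coinexp; apply: eq_in_coinexp => s sn; rewrite polyfunX //.
  by rewrite ltnS -sn (leq_trans (descents_size s)) // leq_addr.
transitivity (polyfun N f (pbexp (map polyC rs) (fun k => 'X^k))); last first.
  rewrite polyfun_pbexp; apply: eq_in_pbexp => k kn; rewrite polyfunX //.
  by rewrite ltnS (leq_trans kn) // leq_addl.
congr polyfun; rewrite descent_pgf pbexp_pgf fibpoly_fact /factpoly.
rewrite rmorph_prod /rs /descent_params [RHS]big_map /=.
apply: eq_bigr => t _.
rewrite comp_polyB comp_polyZ comp_polyX comp_polyC -mul_polyC mulrA -polyCM.
by rewrite [t * _]mulrC.
Qed.

End Law.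

(** * The shuffled deck and the number of correct guesses *)

Section Game.
Local Open Scope nat_scope.

Definition coins n (c : 'I_n -> bool) : seq bool := map c (enum 'I_n).

Lemma iota1S m : iota 1 m.+1 = rcons (iota 1 m) m.+1.
Proof. by rewrite -cats1 -(iotaD 1 m 1) addn1. Qed.

Section Deck.
Variables (m : nat) (c : 'I_m.+1 -> bool).
Let b (j : nat) : bool := nth false (coins c) j.-1.
Let u := [seq j <- iota 1 m | b j].
Let v := rev [seq j <- iota 1 m | ~~ b j].

(** Each card goes around the pile of the larger cards, and card [n] starts it
    whatever its coin. *)
Lemma shelf_shuffle_split : shelf_shuffle c = u ++ m.+1 :: v.
Proof.
rewrite /shelf_shuffle foldl_rev.
pose g j pile := if b j then j :: pile else rcons pile j.
have E : foldr (fun i pile => if c i then (i : nat).+1 :: pile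
            else rcons pile (i : nat).+1) [::] (enum 'I_m.+1) =
         foldr g [::] (iota 1 m.+1).
  rewrite -[1]/(1 + 0) iotaDl -val_enum_ord -map_comp foldr_map.
  elim: (enum 'I_m.+1) => [|i s IH] //=.
  rewrite IH /g /= /b /= /coins (nth_map ord0) ?size_enum_ord ?ltn_ord //.
  by rewrite nth_ord_enum.
rewrite E iota1S -cats1 foldr_cat /= /g /=.
have -> : (if b m.+1 then [:: m.+1] else [:: m.+1]) = [:: m.+1] by case: ifP.
rewrite -/g /u /v; elim: (iota 1 m) => [|j s IH] //=.
rewrite IH /g; case: (b j) => //=.
by rewrite rev_cons -rcons_cons -rcons_cat.
Qed.

End Deck.

Fixpoint pairsum (F : nat -> nat -> nat) (x : nat) (s : seq nat) : nat :=
  if s is y :: s' then F x y + pairsum F y s' else 0.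

Lemma sum_pairsum F x s :
  \sum_(t < size s) F (last x (take t s)) (nth 0 s t) = pairsum F x s.
Proof.
elim: s x => [|y s IH] x /=; first by rewrite big_ord0.
by rewrite big_ord_recl /= -IH.
Qed.

(** Along the labels of the heads, a label fails to follow its predecessor
    exactly when a run of heads starts, and two consecutive runs are separated
    by one descent. The boolean [x == a] tells whether the coin just before the
    window is a head; the last term accounts for a run that has not ended. *)
Lemma pairsum_succ (b : nat -> bool) m a x : x <= a ->
  count b (iota a.+1 m) + (x == a) =
  pairsum (fun j y => j.+1 == y) x [seq j <- iota a.+1 m | b j]
  + descents ((x == a) :: map b (iota a.+1 m))
  + last (x == a) (map b (iota a.+1 m)).
Proof.
elim: m a x => [|m IH] a x xa; first by rewrite /= andbF !add0n.
rewrite [iota _ _]/= [count _ _]/= [[seq _ <- _ | _]]/= [map _ _]/=.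
rewrite [last _ (_ :: _)]/= [descents (_ :: _ :: _)]/=.
have [ba|ba] := boolP (b a.+1).
  rewrite andbF add0n /= eqSS; have := IH a.+1 a.+1 (leqnn _).
  by rewrite eqxx /=; lia.
have := IH a.+1 x (leqW xa); rewrite ltn_eqF ?ltnS //.
by rewrite /= andbT; lia.
Qed.

Lemma count_ge_iota k m : count (fun y => k <= y) (iota 1 m) <= m.+1 - k.
Proof.
elim: m => [|m IH] //.
rewrite iota1S -cats1 count_cat /= addn0.
by case: leqP; lia.
Qed.

Lemma pairsum_ge k x s :
  pairsum (fun j _ => k <= j) x s <= (k <= x) + count (fun y => k <= y) s.
Proof.
elim: s x => [|y s IH] x //=.
by rewrite leq_add2l.
Qed.

Lemma descents_cons b s : descents s <= descents (b :: s) <= (descents s).+1.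
Proof. by rewrite /= ; case: (b && _) => /=; lia. Qed.

Lemma descents_rcons s b :
  descents s <= descents (rcons s b) <= (descents s).+1.
Proof.
elim: s => [|a s]; first by rewrite /= andbF.
by case: s => [|a' s] /=; [case: a; case: b|lia].
Qed.

Section Guess.
Variables (R : realType) (p : R) (m : nat) (b : nat -> bool).
Let u := [seq j <- iota 1 m | b j].
Let v := rev [seq j <- iota 1 m | ~~ b j].
Let deck := u ++ m.+1 :: v.
Let K := absz (nu p).

Let mem_u j : j \in u -> 1 <= j <= m.
Proof. by rewrite mem_filter mem_iota => /andP[_]; rewrite add1n ltnS. Qed.

Let sorted_u : sorted ltn u.
Proof. by apply: sorted_filter; [exact: ltn_trans|exact: iota_ltn_sorted]. Qed.

Let sorted_v : sorted (fun x y => y <= x) v.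
Proof.
rewrite rev_sorted; apply: sorted_filter; first exact: leq_trans.
exact: iota_sorted.
Qed.

Let perm_deck : perm_eq deck (iota 1 m.+1).
Proof.
rewrite /deck iota1S -[m.+1 :: v]cat1s perm_catCA perm_sym perm_rcons perm_sym.
rewrite cat1s perm_cons.
rewrite (perm_trans (y := u ++ [seq j <- iota 1 m | ~~ b j])) //.
  by rewrite perm_cat2l perm_rev.
by rewrite perm_filterC.
Qed.

Let uniq_deck : uniq deck.
Proof. by rewrite (perm_uniq perm_deck) iota_uniq. Qed.

(** Once card [n] is out, the cards left lie in decreasing order, so the
    largest of them is on top. *)
Lemma guess_late t : size u < t < size deck ->
  guess p m.+1 (take t deck) = nth 0 deck t.
Proof.
case/andP=> ut tn; set x := nth 0 deck t.
have dE : deck = take t deck ++ x :: drop t.+1 deck.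
  by rewrite -drop_nth // cat_take_drop.
(* The deck has no repetition, so the cards not shown are those below. *)
have shownP k : k \in iota 1 m.+1 ->
    (k \notin take t deck) = (k \in x :: drop t.+1 deck).
  move=> kn; have : k \in deck by rewrite (perm_mem perm_deck).
  rewrite {1}dE mem_cat; have := uniq_deck; rewrite {1}dE cat_uniq.
  case/and3P=> _ /hasPn disj _; case: (boolP (k \in take t deck)) => //= kt _.
  by apply/esym/negP => /disj; rewrite kt.
have nin : m.+1 \in take t deck.
  rewrite /deck take_cat ltnNge (ltnW ut) /= mem_cat orbC.
  have : 0 < t - size u by rewrite subn_gt0.
  by case: (t - size u) => // k _; rewrite /= inE eqxx.
have -> : guess p m.+1 (take t deck) =
   \max_(k <- iota 1 m.+1 | k \notin take t deck) k.
  by rewrite /guess nin.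
have xin : x \in iota 1 m.+1 by rewrite -(perm_mem perm_deck) mem_nth.
apply/eqP; rewrite eqn_leq; apply/andP; split.
  apply/bigmax_leqP_seq => k kn; rewrite shownP // inE => /predU1P[->//|kd].
  have : sorted (fun x y => y <= x) (x :: drop t.+1 deck).
    rewrite -drop_nth // /deck drop_cat ltnNge (ltnW ut) /=.
    have : 0 < t - size u by rewrite subn_gt0.
    case: (t - size u) => // j _ /=.
    by apply: drop_sorted.
  move=> /(order_path_min _) /= /(_ _) /allP/(_ _ kd); apply.
  by move=> i j k' ij jk; apply: leq_trans jk ij.
apply: (@leq_bigmax_seq _ _ (fun k => k \notin take t deck) (fun k => k) x) => //.
by rewrite shownP // inE eqxx.
Qed.

(** While neither [n] nor [n - 1] is out, the guess can differ from the
    successor of the last card [j] only if [j] is within [nu] of [n]. *)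
Lemma guess_early t : t < size u ->
  let j := last 0 (take t u) in
  (guess p m.+1 (take t deck) == nth 0 deck t) <=
    (j.+1 == nth 0 u t) + (m.+1 - K <= j) /\
  (j.+1 == nth 0 u t) <=
    (guess p m.+1 (take t deck) == nth 0 deck t) + (m.+1 - K <= j).
Proof.
move=> tu j; rewrite /deck take_cat nth_cat tu.
have mu : m.+1 \notin take t u.
  by apply/negP => /mem_take /mem_u; rewrite ltnn andbF.
have mu' : m \notin take t u.
  apply/negP => /(nthP 0) [i]; rewrite size_take tu => it.
  rewrite nth_take // => e.
  have : nth 0 u i < nth 0 u t.
    by apply: (sorted_ltn_nth ltn_trans) => //; rewrite inE // (ltn_trans it).
  rewrite e; have /mem_u /andP[_] := mem_nth 0 tu.
  by rewrite leqNgt => /negP.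
rewrite /guess (negbTE mu) (negbTE mu') /= -/j.
case: ifP => _; first by split; exact: leq_addr.
case: ifP => [nj|_]; last by split; exact: leq_addr.
have -> : m.+1 - K <= j by rewrite /K; lia.
by split; apply: (@leq_trans 1); rewrite ?leq_b1 // leq_addl.
Qed.

Let X := \sum_(t < size deck) (guess p m.+1 (take t deck) == nth 0 deck t).
Let D := descents (map b (iota 1 m.+1)).

(** The sum is cut at the position of card [n]: the guesses after it are all
    correct, and those before it are compared with the successor rule. The
    latter differs from the actual guess at most [K + 1] times, and the guess
    of card [n] itself, the first card and the last coins account for the
    rest of the error. *)
Lemma correct_guesses_split :
  X + D <= m.+1 + (K + 3) /\ m.+1 <= X + D + (K + 3).
Proof.
pose F t := (guess p m.+1 (take t deck) == nth 0 deck t) : nat.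
have szu : size u = count b (iota 1 m) by rewrite size_filter.
have szv : size v + size u = m.
  by rewrite szu size_rev size_filter addnC -[RHS](size_iota 1 m) count_predC.
have szd : size deck = (size u + 1) + size v by rewrite size_cat /= addn1 addnS.
have XE : X = \sum_(0 <= t < size u) F t + F (size u) + size v.
  rewrite /X -(big_mkord xpredT F) szd (big_cat_nat (n := size u + 1)) ?leq_addr //=.
  rewrite addn1 big_nat_recr //=; congr (_ + _).
  rewrite (eq_big_nat _ _ (F2 := fun=> 1)); last first.
    by move=> t /andP[t1 t2]; rewrite /F guess_late ?eqxx // t1 szd addn1.
  by rewrite big_const_nat iter_addn_0 mul1n addKn.
pose S1 := pairsum (fun j y => j.+1 == y) 0 u.
pose S2 := pairsum (fun j _ => m.+1 - K <= j) 0 u.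
have S2_le : S2 <= K + 1.
  apply: (leq_trans (pairsum_ge _ _ _)); rewrite addnC leq_add ?leq_b1 //.
  apply: (@leq_trans (count (fun y => m.+1 - K <= y) (iota 1 m))).
    by rewrite count_filter; apply: sub_count => y /= /andP[].
  by apply: (leq_trans (count_ge_iota _ _)); lia.
have H1 : \sum_(0 <= t < size u) F t <= S1 + S2.
  rewrite /S1 /S2 -!sum_pairsum big_mkord -big_split /=.
  by apply: leq_sum => t _; case: (guess_early (ltn_ord t)).
have H2 : S1 <= \sum_(0 <= t < size u) F t + S2.
  rewrite /S1 /S2 -!sum_pairsum big_mkord -big_split /=.
  by apply: leq_sum => t _; case: (guess_early (ltn_ord t)).
have F1 : F (size u) <= 1 by rewrite leq_b1.
have := pairsum_succ b m (leqnn 0); rewrite eqxx -szu -/u -/S1.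
have := descents_cons true (map b (iota 1 m)).
have : D = descents (rcons (map b (iota 1 m)) (b m.+1)) by rewrite /D iota1S map_rcons.
have := descents_rcons (map b (iota 1 m)) (b m.+1).
case: (last true _); rewrite XE; lia.
Qed.

End Guess.

(** Up to a bounded error, every card is guessed correctly except one per
    descent of the coin sequence. *)
Lemma correct_guesses_descents (R : realType) (p : R) n (c : 'I_n -> bool) :
  let X := correct_guesses p n (shelf_shuffle c) in
  let D := descents (coins c) in
  X + D <= n + (absz (nu p) + 3) /\ n <= X + D + (absz (nu p) + 3).
Proof.
case: n c => [|m] c /=.
  rewrite /correct_guesses /shelf_shuffle /coins.
  by rewrite (size0nil (size_enum_ord 0)) /= big_ord0; lia.
pose b (j : nat) : bool := nth false (coins c) j.-1.
have E : coins c = map b (iota 1 m.+1).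
  apply: (@eq_from_nth _ false) => [|i].
    by rewrite (size_map c) (size_map b) size_enum_ord size_iota.
  rewrite (size_map c) size_enum_ord => im.
  rewrite (nth_map 0) ?size_iota // nth_iota // add1n /b //.
rewrite [descents _](congr1 descents E) /correct_guesses shelf_shuffle_split.
exact: (correct_guesses_split p m b).
Qed.

End Game.

(** * Expectations of functions of the coins *)

Section TupleSum.
Variables (A : numDomainType) (p : A).

Lemma coinexp_tuple n (g : seq bool -> A) :
  coinexp p n g = \sum_(t : n.-tuple bool) (\prod_(b <- t) bernoulli_pmf p b) * g t.
Proof.
elim: n g => [|n IH] g /=.
  rewrite (bigD1 [tuple]) //= big_nil mul1r big1 ?addr0 // => t /eqP[].
  exact: tuple0.
rewrite !IH !big_distrr /=.
rewrite (reindex (fun x : bool * n.-tuple bool => cons_tuple x.1 x.2)) /=; last first.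
  exists (fun t : n.+1.-tuple bool => (thead t, behead_tuple t)).
    by case=> b t _ /=; congr (_, _); apply: val_inj.
  by move=> t _ /=; rewrite [RHS]tuple_eta; apply: val_inj.
rewrite -(pair_bigA _ (fun b (t : n.-tuple bool) =>
   (\prod_(a <- cons_tuple b t) bernoulli_pmf p a) * g (cons_tuple b t))) /=.
rewrite (bigD1 false) //= (bigD1 true) //= [X in _ + (_ + X)]big1 ?addr0; last first.
  by case.
by congr (_ + _); apply: eq_bigr => t _; rewrite big_cons mulrA.
Qed.

End TupleSum.

Section Coins.
Context d (T : measurableType d) (R : realType) (P : probability T R).
Variables (p : R) (n : nat) (eps : 'I_n -> {RV P >-> bool}).
Hypotheses (p01 : 0 <= p <= 1) (iid : iid_bernoulli p eps).

Let C w : seq bool := coins (fun i => eps i w).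
Let event (t : n.-tuple bool) : set T := [set w | C w = t].

Let eventE t : event t =
  \bigcap_(i in [set` finset.setTfor 'I_n]) (eps i @^-1` [set tnth t i]).
Proof.
apply/seteqP; split => w /=.
  move=> Cw i _ /=; rewrite (tnth_nth false) -Cw /C /coins.
  by rewrite (nth_map i) ?size_enum_ord // nth_ord_enum.
move=> H; apply: (@eq_from_nth _ false) => [|i].
  by rewrite size_map size_enum_ord size_tuple.
rewrite size_map size_enum_ord => im.
pose j := Ordinal im; rewrite /C /coins (nth_map j) ?size_enum_ord //.
rewrite (nth_ord_enum j j) -[RHS](tnth_nth false t j).
by apply: H; exact: finset.in_setT.
Qed.

Let measurable_event t : measurable (event t).
Proof.
rewrite eventE; apply: fin_bigcap_measurable => [|i _]; first exact: finite_finset.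
by rewrite -[X in measurable X]setTI; apply: measurable_funP.
Qed.

Let P_event t : P (event t) = (\prod_(b <- t) bernoulli_pmf p b)%:E.
Proof.
case: iid => ind ber; rewrite eventE.
have /= -> // := ind (finset.setTfor 'I_n) (fun i => [set tnth t i]).
rewrite big_tuple -prodEFin.
apply: eq_big => [i|i _]; first exact: finset.in_setT.
have := ber i [set tnth t i]; rewrite /distribution /= /pushforward => ->.
rewrite bernoulli_probE // !diracE.
have inb (a b : bool) : (a \in [set b]) = (a == b).
  by apply/idP/eqP => [/set_mem //|->]; exact: mem_set.
by rewrite !inb; case: (tnth t i); rewrite /= ?mule0 ?mule1 ?adde0 ?add0e.
Qed.

Lemma expectation_coins (g : seq bool -> R) :
  'E_P[fun w => g (C w)]%E = (coinexp p n g)%:E.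
Proof.
have gE w : (g (C w))%:E =
    (\sum_(t : n.-tuple bool) (g t)%:E * (\1_(event t) w)%:E)%E.
  have Ct : size (C w) == n by rewrite size_map size_enum_ord.
  rewrite (bigD1 (Tuple Ct)) //= big1 ?adde0.
    by rewrite indicE mem_set //= mule1.
  move=> t /eqP tC; rewrite indicE memNset ?mule0 // => Cw.
  by apply: tC; apply: val_inj.
rewrite unlock; under eq_integral do rewrite gE.
rewrite integral_sum //; last first.
  by move=> t; apply: integrableZl => //; apply: integrable_indic.
rewrite coinexp_tuple -sumEFin; apply: eq_bigr => t _.
rewrite integralZl //; last exact: integrable_indic.
rewrite integral_indic // setIT [RHS]EFinM [RHS]muleC; congr (_ * _)%E.
exact: P_event.
Qed.

Lemma probability_coins (Q : pred (seq bool)) :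
  P [set w | Q (C w)] = (coinexp p n (fun s => (Q s)%:R))%:E.
Proof.
rewrite -expectation_coins -expectation_indic.
  by congr expectation; apply/funext => w; rewrite indicE; congr (_%:R); rewrite mem_setE.
rewrite (_ : [set w | _] = \bigcup_(t in [set t : n.-tuple bool | Q t]) event t).
  by apply: fin_bigcup_measurable => //; exact: finite_finset.
apply/seteqP; split => w /=.
  have Ct : size (C w) == n by rewrite size_map size_enum_ord.
  by move=> Qw; exists (Tuple Ct).
by case=> t Qt Cw; rewrite (_ : C w = t).
Qed.

End Coins.

(** * From descents to correct guesses *)

Section PhiRegular.
Variable R : realType.
Implicit Types x y : R.

Lemma phi_le x : phi x <= expR (- (x ^+ 2 / 2)).
Proof.
rewrite /phi mulNr ler_piMl ?expR_ge0 // invf_le1 ?sqrt2pi_gt0 //.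
rewrite -[leLHS]sqrtr1 ler_wsqrtr //.
by have := @pi_ge2 R; lra.
Qed.

Lemma Phi_MVT x y : x <= y -> exists2 c, x <= c <= y &
  Phi y - Phi x = phi c * (y - x).
Proof.
move=> xy; have cP : {within `[x, y], continuous (@Phi R)}.
  apply: derivable_within_continuous => z _.
  by have [] := is_derive_Phi z.
by have [c] := MVT_segment xy (fun z _ => is_derive_Phi z) cP; exists c.
Qed.

Lemma Phi_lip x y : `|Phi x - Phi y| <= `|x - y|.
Proof.
wlog xy : x y / y <= x.
  move=> H; have [/H //|/ltW/H] := leP y x.
  by rewrite distrC (distrC y).
have [c _ ->] := Phi_MVT xy.
rewrite normrM ler_piMl // gtr0_norm ?phi_gt0 //.
apply: (le_trans (phi_le c)); rewrite expR_le1 oppr_le0.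
by rewrite divr_ge0 ?sqr_ge0.
Qed.

Lemma mul_phi_le1 x : `|x| * phi x <= 1.
Proof.
apply: (@le_trans _ _ (`|x| * expR (- (x ^+ 2 / 2)))).
  by rewrite ler_wpM2l ?phi_le.
rewrite expRN ler_pdivrMr ?expR_gt0 // mul1r.
apply: le_trans (expR_ge1Dx _).
rewrite -[x ^+ 2]real_normK ?num_real //; set a := `|x|.
by have := sqr_ge0 (a - 1); lra.
Qed.

(** The density at a point [c] between [x] and [rho * x] is at most
    [1 / |c|], and [|x| <= 2 |c|]. *)
Lemma Phi_scale x (rho : R) : `|rho - 1| <= 2^-1 ->
  `|Phi (rho * x) - Phi x| <= 2 * `|rho - 1|.
Proof.
move=> rho2; wlog x0 : x / 0 <= x.
  move=> H; have [/H //|/ltW x0] := leP 0 x.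
  have := H (- x); rewrite oppr_ge0 => /(_ x0); rewrite mulrN !PhiN.
  by rewrite opprB addrC addrA subrK distrC.
move: rho2; rewrite ler_norml => /andP[r1 r2].
have key l r : l <= r -> x <= 2 * l -> `|r - l| = `|rho - 1| * x ->
    `|Phi r - Phi l| <= 2 * `|rho - 1|.
  move=> lr xl e; have [c /andP[lc cr] ->] := Phi_MVT lr.
  rewrite normrM e gtr0_norm ?phi_gt0 // mulrC -mulrA mulrC ler_wpM2r //.
  apply: (@le_trans _ _ (2 * (`|c| * phi c))).
    rewrite mulrA ler_wpM2r ?(ltW (phi_gt0 _)) //.
    by apply: (le_trans xl); rewrite ler_wpM2l // (le_trans lc) ?ler_norm.
  by rewrite -[leRHS]mulr1 ler_wpM2l // mul_phi_le1.
have e : `|rho * x - x| = `|rho - 1| * x.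
  by rewrite -{2}[x]mul1r -mulrBl normrM (ger0_norm x0).
have [le|/ltW ge] := leP x (rho * x).
  by apply: key => //; lra.
by rewrite distrC; apply: key; rewrite // ?(distrC x) //; nra.
Qed.

End PhiRegular.

Section CoinExpectation.
Variables (R : realType) (p : R) (n : nat).
Implicit Types f g : seq bool -> R.
Local Notation E := (coinexp p n).

Lemma coinexpD f g : E (fun s => f s + g s) = E f + E g.
Proof.
elim: n f g => [|k IH] f g //=.
rewrite (IH (fun s => f (false :: s)) (fun s => g (false :: s))).
by rewrite (IH (fun s => f (true :: s)) (fun s => g (true :: s))); ring.
Qed.

Lemma coinexp_cst a : E (fun=> a) = a.
Proof. by elim: n => [|k IH] //=; rewrite IH; ring. Qed.

Lemma coinexpB f g : E (fun s => f s - g s) = E f - E g.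
Proof.
rewrite -mulN1r -coinexpZ -coinexpD; apply: eq_in_coinexp => s _.
by rewrite mulN1r.
Qed.

Hypothesis p01 : 0 <= p <= 1.

Lemma le_coinexp f g : (forall s, size s = n -> f s <= g s) -> E f <= E g.
Proof.
case/andP: p01 => p0 p1; elim: n f g => [|k IH] f g fg /=; first exact: fg.
by apply: lerD; rewrite ler_wpM2l ?subr_ge0 //; apply: IH => s sk;
   apply: fg; rewrite /= sk.
Qed.

Lemma ler_norm_coinexp f : `|E f| <= E (fun s => `|f s|).
Proof.
rewrite ler_norml -mulN1r -coinexpZ; apply/andP; split; apply: le_coinexp => s _.
  by rewrite mulN1r lerNl -normrN ler_norm.
exact: ler_norm.
Qed.

(** The mean and the standard deviation of a statistic [Y] within [K] of
    [n - descents] are within constants of those of [n - descents]. The event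
    [Y <= y] is therefore squeezed between two events of the form
    [a < descents], whose thresholds differ by a constant. *)
Section Transfer.
Variables (K sd : R) (Y : seq bool -> R).
Hypothesis Y_near : forall s, size s = n ->
  `|Y s + (descents s)%:R - n%:R| <= K.
Hypothesis K0 : 0 <= K.
Hypothesis sd_var : sd ^+ 2 = pbvar (descent_params p n).
Hypothesis params01 : all (@in01 R) (descent_params p n).

(** With [Y - E Y = (E D - D) + e] and [|e| <= 2 K], the variances differ by at
    most [4 K E|D - E D| + 4 K^2], and dividing by the standard deviation, which
    is at least [1], bounds the difference of the standard deviations. *)
Definition sd_shift : R := 4 * K + 4 * K ^+ 2.

Hypothesis sd_large : 1 + 2 * sd_shift <= sd.

Let mu := pbmean (descent_params p n).
Let D (s : seq bool) : R := (descents s)%:R.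
Let m := E Y.
Let V := E (fun s => (Y s - m) ^+ 2).
Let sigma := Num.sqrt V.

Let K2_ge0 : 0 <= sd_shift.
Proof. by rewrite addr_ge0 // mulr_ge0 ?sqr_ge0. Qed.
Let sd1 : 1 <= sd.
Proof. by apply: le_trans sd_large; rewrite lerDl mulr_ge0. Qed.
Let sd0 : 0 < sd. Proof. exact: lt_le_trans sd1. Qed.

Let mean_D : E D = mu.
Proof.
rewrite (descents_law p n (fun k => k%:R)); apply/eqP; rewrite -subr_eq0.
rewrite -[X in _ - X](pbexp_cst (descent_params p n)) -pbexpB; apply/eqP.
transitivity (pbstein (descent_params p n) (fdiff (fun=> 1))).
  by rewrite -pbexp_stein; apply: eq_pbexp => k; rewrite mulr1.
rewrite (@eq_pbstein _ _ _ (fun=> 0)) ?pbstein_cst ?mul0r // => k.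
by rewrite /fdiff subrr.
Qed.

Let var_D : E (fun s => (D s - mu) ^+ 2) = sd ^+ 2.
Proof.
by rewrite (descents_law p n (fun k => (k%:R - mu) ^+ 2)) pbexp_variance.
Qed.

Let dev_D : E (fun s => `|D s - mu|) <= sd.
Proof.
by rewrite (descents_law p n (fun k => `|k%:R - mu|)) pbexp_abs_dev.
Qed.

Let m_near : `|m + mu - n%:R| <= K.
Proof.
rewrite -mean_D -[n%:R]coinexp_cst -coinexpD -coinexpB.
apply: (le_trans (ler_norm_coinexp _)); rewrite -[leRHS]coinexp_cst.
exact: le_coinexp.
Qed.

Let V_near : `|V - sd ^+ 2| <= sd_shift * sd.
Proof.
rewrite -var_D -coinexpB; apply: (le_trans (ler_norm_coinexp _)).
apply: (@le_trans _ _ (E (fun s => 4 * K * `|D s - mu| + 4 * K ^+ 2))).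
  apply: le_coinexp => s sn; set e := Y s + D s - m - mu.
  have e2 : `|e| <= 2 * K.
    have -> : e = (Y s + D s - n%:R) - (m + mu - n%:R) by rewrite /e; ring.
    apply: (le_trans (ler_normB _ _)).
    by rewrite mulr_natl mulr2n lerD ?Y_near.
  have -> : (Y s - m) ^+ 2 - (D s - mu) ^+ 2 = e ^+ 2 - 2 * e * (D s - mu).
    by rewrite /e; ring.
  apply: (le_trans (ler_normB _ _)); rewrite addrC !normrM lerD //.
    by rewrite ler_wpM2r // ger0_norm //; lra.
  have -> : 4 * K ^+ 2 = (2 * K) * (2 * K) by ring.
  by rewrite ler_pM.
rewrite coinexpD coinexpZ coinexp_cst /sd_shift [leRHS]mulrDl lerD //.
  by rewrite ler_wpM2l // mulr_ge0.
by rewrite ler_peMr // mulr_ge0 ?sqr_ge0.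
Qed.

Let V0 : 0 <= V.
Proof.
by rewrite -(coinexp_cst 0); apply: le_coinexp => s _; exact: sqr_ge0.
Qed.

Let sigma_near : `|sigma - sd| <= sd_shift.
Proof.
have sg0 : 0 <= sigma by rewrite sqrtr_ge0.
have : `|sigma - sd| * (sigma + sd) <= sd_shift * sd.
  have e : 0 <= sigma + sd by rewrite addr_ge0 // ltW.
  rewrite -{1}(ger0_norm e) -normrM.
  have -> : (sigma - sd) * (sigma + sd) = sigma ^+ 2 - sd ^+ 2 by ring.
  by rewrite sqr_sqrtr.
move=> H; rewrite -(ler_pM2r sd0); apply: le_trans H.
by rewrite ler_wpM2l // lerDr.
Qed.

Let sigma0 : 0 < sigma.
Proof.
move: sigma_near; rewrite ler_norml => /andP[h _].
have := K2_ge0; have := sd_large; lra.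
Qed.

Let cdfD a : E (fun s => (D s <= a)%R%:R) =
  pbexp (descent_params p n) (fun k => (k%:R <= a)%R%:R).
Proof. exact: (descents_law p n (fun k => (k%:R <= a)%R%:R)). Qed.

(* The tail of the descents above a threshold within a constant of
   [mu - x * sigma] is [Phi x] up to a shift of [Phi] by [eta / sd], a dilation
   by [sigma / sd] and the Kolmogorov error. *)
Let near_Phi (x eta a : R) : `|eta| <= 2 * K + 1 -> a = mu - x * sigma + eta ->
  `|1 - E (fun s => (D s <= a)%R%:R) - Phi x| <=
    (pb_const R + (2 * K + 1) + 2 * sd_shift) / sd.
Proof.
move=> eta_le ->; set a' := _ + eta.
have := pb_kolmogorov a' params01 sd1 sd_var; rewrite -cdfD => H.
set y := (a' - _) / sd in H.
pose rho := sigma / sd.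
have yE : - y = rho * x - eta / sd by rewrite /y /a' /rho -/mu; ring.
have -> : 1 - E (fun s => (D s <= a')%R%:R) - Phi x =
  (Phi (- y) - Phi (rho * x)) + (Phi (rho * x) - Phi x)
   - (E (fun s => (D s <= a')%R%:R) - Phi y) by rewrite PhiN; ring.
rewrite [leRHS](_ : _ = (2 * K + 1) / sd + 2 * (sd_shift / sd) + pb_const R / sd);
  last by ring.
apply: (le_trans (ler_normB _ _)); apply: lerD => //.
apply: (le_trans (ler_normD _ _)); apply: lerD.
  apply: (le_trans (Phi_lip _ _)); rewrite yE addrAC subrr sub0r normrN normrM.
  rewrite [X in _ * X]ger0_norm ?invr_ge0 ?(ltW sd0) //.
  by rewrite ler_wpM2r // invr_ge0 ltW.
have rho1 : `|rho - 1| <= sd_shift / sd.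
  have -> : rho - 1 = (sigma - sd) / sd by rewrite mulrBl divff // gt_eqF.
  rewrite normrM [X in _ * X]ger0_norm ?invr_ge0 ?(ltW sd0) //.
  by rewrite ler_wpM2r // invr_ge0 ltW.
apply: (le_trans (Phi_scale _ _)).
  by apply: (le_trans rho1); rewrite ler_pdivrMr //; have := sd_large; lra.
by rewrite ler_wpM2l.
Qed.

Lemma descents_transfer (x : R) :
  `|E (fun s => ((Y s - m) / sigma <= x)%R%:R) - Phi x| <=
    (pb_const R + (2 * K + 1) + 2 * sd_shift) / sd.
Proof.
set c := _ / sd; set Q := E _.
have ev s : ((Y s - m) / sigma <= x) = (Y s <= m + x * sigma).
  by rewrite ler_pdivrMr // lerBlDl.
move: m_near; rewrite ler_norml => /andP[d1 d2].
pose a1 := n%:R + K - m - x * sigma.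
pose a2 := n%:R - K - m - x * sigma - 1.
have B1 : 1 - E (fun s => (D s <= a1)%R%:R) <= Q.
  rewrite -[X in X - _](coinexp_cst 1) -coinexpB; apply: le_coinexp => s sn.
  rewrite ev; have := Y_near sn; rewrite ler_norml -/(D s) => /andP[y1 y2].
  have [Da|Da] := leP (D s) a1; first by rewrite /= mulr1n subrr ler0n.
  by rewrite /= mulr0n subr0 (_ : Y s <= _) //; move: Da; rewrite /a1; lra.
have B2 : Q <= 1 - E (fun s => (D s <= a2)%R%:R).
  rewrite -[X in _ <= X - _](coinexp_cst 1) -coinexpB; apply: le_coinexp => s sn.
  rewrite ev; have := Y_near sn; rewrite ler_norml -/(D s) => /andP[y1 y2].
  have [Ya|Ya] := leP (Y s) _; last by rewrite /= mulr0n subr_ge0 lern1 leq_b1.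
  by rewrite [D s <= a2]leNgt (_ : a2 < D s) ?subr0 //; rewrite /a2; lra.
have : `|1 - E (fun s => (D s <= a1)%R%:R) - Phi x| <= c.
  apply: (@near_Phi x (n%:R + K - m - mu)); last by rewrite /a1; ring.
  by rewrite ler_norml; apply/andP; split; lra.
have : `|1 - E (fun s => (D s <= a2)%R%:R) - Phi x| <= c.
  apply: (@near_Phi x (n%:R - K - m - mu - 1)); last by rewrite /a2; ring.
  by rewrite ler_norml; apply/andP; split; lra.
rewrite !ler_norml => /andP[h1 h2] /andP[h3 h4]; apply/andP; split; lra.
Qed.

End Transfer.
End CoinExpectation.

(** * The theorem *)

Definition correct_of_coins (R : realType) (p : R) (n : nat) (s : seq bool) : R :=
  (correct_guesses p n (shelf_shuffle (fun i : 'I_n => nth false s i)))%:R.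

Definition guess_error (R : realType) (p : R) : R := (absz (nu p) + 3)%:R.

Section Correct.
Variables (R : realType) (p : R) (n : nat).

Lemma nth_coins (c : 'I_n -> bool) (i : 'I_n) : nth false (coins c) i = c i.
Proof. by rewrite /coins (nth_map i) ?size_enum_ord // nth_ord_enum. Qed.

Lemma coins_nth s : size s = n -> coins (fun i : 'I_n => nth false s i) = s.
Proof.
move=> sn; apply: (@eq_from_nth _ false); first by rewrite size_map size_enum_ord.
move=> i; rewrite size_map size_enum_ord => im.
exact: (nth_coins (fun i : 'I_n => nth false s i) (Ordinal im)).
Qed.

Lemma correct_of_coins_near s : size s = n ->
  `|correct_of_coins p n s + (descents s)%:R - n%:R| <= guess_error p.
Proof.
move=> sn.
have := correct_guesses_descents p (fun i : 'I_n => nth false s i).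
rewrite /= (coins_nth sn) /correct_of_coins /guess_error; set x := correct_guesses _ _ _.
case; rewrite -(ler_nat R) -(ler_nat R n) natrD [X in _ <= X -> _]natrD => h1.
rewrite natrD [X in _ <= X + _ -> _]natrD => h2.
by rewrite ler_norml; apply/andP; split; lra.
Qed.

Section Random.
Context d (T : measurableType d) (P : probability T R).
Variable eps : 'I_n -> {RV P >-> bool}.
Hypotheses (p01 : 0 <= p <= 1) (iid : iid_bernoulli p eps).

Let Y := correct_of_coins p n.
Let m := coinexp p n Y.
Let V := coinexp p n (fun s => (Y s - m) ^+ 2).

Let num_correctE :
  num_correct p eps = fun w => Y (coins (fun i => eps i w)).
Proof.
apply/funext => w; rewrite /num_correct /Y /correct_of_coins.
by congr (correct_guesses _ _ (shelf_shuffle _))%:R; apply/funext => i; rewrite nth_coins.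
Qed.

Lemma expectation_num_correct : 'E_P[num_correct p eps]%E = m%:E.
Proof. by rewrite num_correctE (expectation_coins p01 iid). Qed.

Lemma variance_num_correct : 'V_P[num_correct p eps]%E = V%:E.
Proof.
rewrite /variance unlock expectation_num_correct num_correctE.
rewrite -[RHS](expectation_coins p01 iid (fun s => (Y s - m) ^+ 2)).
by congr expectation; apply/funext => w; rewrite expr2.
Qed.

Lemma cdf_num_correct (sigma x : R) :
  P [set w | (num_correct p eps w - m) / sigma <= x] =
  (coinexp p n (fun s => ((Y s - m) / sigma <= x)%R%:R))%:E.
Proof.
rewrite num_correctE.
exact: (probability_coins p01 iid (fun s => (Y s - m) / sigma <= x)).
Qed.

End Random.
End Correct.

Lemma pb_const_ge0 (R : realType) : 0 <= pb_const R.
Proof. by rewrite /pb_const addr_ge0 // mulr_ge0 // mills_max_ge0. Qed.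

Theorem theorem4 (R : realType) (p : R) (p_gt0 : 0 < p) (p_lt1 : p < 1) :
  exists2 C : R, 0 < C &
  exists N : nat, forall n : nat, (N <= n)%N ->
  forall (d : measure_display) (T : measurableType d) (P : probability T R)
         (eps : 'I_n -> {RV P >-> bool}),
  iid_bernoulli p eps ->
  let X := num_correct p eps in
  forall x : R,
    `| fine (P [set w | (X w - fine 'E_P[X]) / Num.sqrt (fine 'V_P[X]) <= x])
       - Phi x | <= C / Num.sqrt n%:R.
Proof.
have p01 : 0 <= p <= 1 by rewrite !ltW.
have p01' : 0 < p < 1 by rewrite p_gt0.
set K := guess_error p; have K0 : 0 <= K by rewrite /K ler0n.
have S0 : 0 <= sd_shift K.
  by rewrite addr_ge0 // mulr_ge0 ?sqr_ge0.
pose kappa := p * (1 - p) / 4.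
have kappa0 : 0 < kappa by rewrite divr_gt0 // mulr_gt0 // subr_gt0.
pose c := pb_const R + (2 * K + 1) + 2 * sd_shift K.
have c0 : 0 < c.
  by rewrite ltr_pwDl ?mulr_ge0 // ltr_wpDl ?pb_const_ge0 // ltr_wpDl ?mulr_ge0.
exists (c / Num.sqrt kappa); first by rewrite divr_gt0 // sqrtr_gt0.
exists (maxn 2 (Num.truncn ((1 + 2 * sd_shift K) ^+ 2 / kappa)).+1) => n.
rewrite geq_max => /andP[n2 nN] d T P eps iid X x.
pose sd := Num.sqrt (pbvar (descent_params p n)).
have params := descent_params01 p01' n.
have sdV : sd ^+ 2 = pbvar (descent_params p n) by rewrite sqr_sqrtr // pbvar_ge0.
have sd_ge : Num.sqrt (kappa * n%:R) <= sd.
  by rewrite ler_wsqrtr //; case: n n2 {nN eps iid X sd params sdV} => [|[|n]] // _;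
     exact: pbvar_descent_params.
have sd_large : 1 + 2 * sd_shift K <= sd.
  apply: le_trans sd_ge.
  have e0 : 0 <= 1 + 2 * sd_shift K by rewrite addr_ge0 // mulr_ge0.
  rewrite -(ger0_norm e0) -sqrtr_sqr ler_wsqrtr // [kappa * _]mulrC -ler_pdivrMr //.
  apply: (le_trans (ltW (truncnS_gt _))). by rewrite ler_nat.
rewrite /X (expectation_num_correct p01 iid) (variance_num_correct p01 iid) /=.
rewrite (cdf_num_correct p01 iid) /=.
apply: (le_trans (descents_transfer p01 (@correct_of_coins_near R p n) K0 sdV
  params sd_large x)).
rewrite -/c -mulrA -invfM ler_wpM2l ?(ltW c0) // lef_pV2 ?posrE.
- by rewrite -sqrtrM ?(ltW kappa0).
- by apply: lt_le_trans sd_large; rewrite ltr_pwDl // mulr_ge0.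
- by rewrite mulr_gt0 // sqrtr_gt0 // ltr0n (leq_trans _ n2).
Qed.
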